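(* Let $k\in\mathbb{N}$, $k\ge 1$, and let $\mathcal{G}_{2k}$ be the finite dimensional Grassmann algebra $\langle 1,e_1,\dots,e_{2k}\mid e_ie_j=-e_je_i\rangle$ over $F$, regarded as a superalgebra with the trivial grading. Then: (1) $c_n^{gr,z}(\mathcal{G}_{2k})=\sum_{i=0}^{k-1}\binom{n-1}{2i}$; (2) $\delta_n^{gr}(\mathcal{G}_{2k})=\binom{n}{2k}+\sum_{i=0}^{k-2}\binom{n-1}{2i+1}$; (3) $\chi_n^{gr,z}(\mathcal{G}_{2k})=\sum_{i=0}^{k-1}\chi_{(n-2i,1^{2i}),\emptyset}$; (4) $\chi_n(\Delta^{gr}(\mathcal{G}_{2k}))=\chi_{(n-2k,1^{2k}),\emptyset}+\sum_{i=0}^{k-1}\chi_{(n-2i-1,1^{2i+1}),\emptyset}$.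
   Context: $F$ is a field of characteristic zero. A superalgebra is an algebra $A=A_0\oplus A_1$ with $A_iA_j\subseteq A_{i+j\bmod 2}$ (trivial grading: $A_1=0$); $Z(A)$ is the center. $F\langle Y,Z\rangle$ is the free algebra on even variables $y_1,y_2,\dots$ and odd variables $z_1,z_2,\dots$. $\mathrm{Id}^{gr}(A)$ is the set of graded identities (polynomials vanishing under all substitutions of even variables by elements of $A_0$ and odd ones by elements of $A_1$); $C^{gr}(A)$ is the set of central graded polynomials (zero constant term, all such evaluations lie in $Z(A)$). $P_n^{gr}$ is the span of monomials $w_{\sigma(1)}\cdots w_{\sigma(n)}$, $\sigma\in S_n$, $w_i\in\{y_i,z_i\}$; $c_n^{gr,z}(A)=\dim P_n^{gr}/(P_n^{gr}\cap C^{gr}(A))$, $\delta_n^{gr}(A)=\dim(P_n^{gr}\cap C^{gr}(A))/(P_n^{gr}\cap\mathrm{Id}^{gr}(A))$. $\mathbb{Z}_2\wr S_n$ acts on $P_n^{gr}$ by $(a_1,\dots,a_n;\sigma)y_i=y_{\sigma(i)}$, $(a_1,\dots,a_n;\sigma)z_i=a_{\sigma(i)}z_{\sigma(i)}$ ($a_j=\pm1$); $\chi_n^{gr,z}(A)$ and $\chi_n(\Delta^{gr}(A))$ are the characters of the modules $P_n^{gr}/(P_n^{gr}\cap C^{gr}(A))$ and $(P_n^{gr}\cap C^{gr}(A))/(P_n^{gr}\cap\mathrm{Id}^{gr}(A))$. $\chi_{\lambda,\mu}$ is the irreducible $\mathbb{Z}_2\wr S_n$-character indexed by $\lambda\vdash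 n-r$ (even variables), $\mu\vdash r$ (odd variables); $\emptyset$ is the empty partition and $1^j$ denotes $j$ parts equal to $1$. *)

(* Defs.v *)
From HB Require Import structures.
From mathcomp Require Import all_boot all_order all_algebra all_fingroup.
Set Implicit Arguments. Unset Strict Implicit. Unset Printing Implicit Defensive.
Import GRing.Theory.
Local Open Scope ring_scope.

(* Linear algebra helper: trace of a linear map L (acting on row       *)
(* vectors, v |-> v *m L) restricted to the row space of U, assumed    *)
(* L-stable.  row_base U is a basis; pinvmx gives coordinates.         *)
Definition restr_trace (F : fieldType) (m N : nat) (U : 'M[F]_(m, N))
    (L : 'M[F]_N) : F :=
  \tr (row_base U *m L *m pinvmx (row_base U)).

Definition spans (F : fieldType) (m N : nat) (P : 'rV[F]_N -> Prop)
    (U : 'M[F]_(m, N)) : Prop :=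
  forall f : 'rV[F]_N, (f <= U)%MS <-> P f.

(* The multilinear graded space P_n^gr.  A basis monomial is a pair    *)
(* (c, t) with c : 'I_n -> bool (c i = true : w_i = z_i odd,           *)
(* c i = false : w_i = y_i even) and t a permutation; it stands for    *)
(* w_{t 0} w_{t 1} ... w_{t (n-1)}.                                    *)
(* An element of P_n^gr is a row vector of coefficients.               *)
Definition mono (n : nat) := ({ffun 'I_n -> bool} * {perm 'I_n})%type.
Definition PN (n : nat) := #|{: mono n}|.

(* Evaluation in an algebra A (F-module with a bilinear product mul and *)
(* unit one): even variable y_i |-> a i, odd variable z_i |-> b i.     *)
Definition mono_val (F : fieldType) (A : lmodType F) (mul : A -> A -> A)
    (one : A) (n : nat) (a b : 'I_n -> A) (m : mono n) : A :=
  \big[mul/one]_(j < n) (if m.1 (m.2 j) then b (m.2 j) else a (m.2 j)).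

Definition poly_eval (F : fieldType) (A : lmodType F) (mul : A -> A -> A)
    (one : A) (n : nat) (f : 'rV[F]_(PN n)) (a b : 'I_n -> A) : A :=
  \sum_(m : mono n) f 0 (enum_rank m) *: mono_val mul one a b m.

Definition in_center (F : fieldType) (A : lmodType F) (mul : A -> A -> A)
    (x : A) : Prop := forall y : A, mul x y = mul y x.

(* A superalgebra is given by (A, mul, one) and the homogeneous        *)
(* components A0, A1 (as predicates).                                   *)
(* f in P_n^gr is central: all graded evaluations lie in Z(A).         *)
(* (For n >= 1 elements of P_n^gr have zero constant term.)            *)
Definition central_gr (F : fieldType) (A : lmodType F) (mul : A -> A -> A)
    (one : A) (A0 A1 : pred A) (n : nat) (f : 'rV[F]_(PN n)) : Prop :=
  forall a b : 'I_n -> A, (forall i, a i \in A0) -> (forall i, b i \in A1) ->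
    in_center mul (poly_eval mul one f a b).

Definition ident_gr (F : fieldType) (A : lmodType F) (mul : A -> A -> A)
    (one : A) (A0 A1 : pred A) (n : nat) (f : 'rV[F]_(PN n)) : Prop :=
  forall a b : 'I_n -> A, (forall i, a i \in A0) -> (forall i, b i \in A1) ->
    poly_eval mul one f a b = 0.

(* Action of Z_2 wr S_n on P_n^gr.  An element (a_1..a_n; s) is a pair *)
(* (a, s) with a : {ffun 'I_n -> bool}, a j = true meaning a_j = -1.   *)
(* (a; s) y_i = y_{s i},  (a; s) z_i = a_{s i} z_{s i}.                 *)
(* The monomial (c, t) is sent to sign * (c o s^-1, s o t); note that   *)
(* in MathComp (t * s)%g is the composite  j |-> s (t j).               *)
Definition act_mono (n : nat) (s : {perm 'I_n}) (m : mono n) : mono n :=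
  ([ffun i => m.1 ((s^-1)%g i)], (m.2 * s)%g).

Definition act_sign (F : fieldType) (n : nat) (a : {ffun 'I_n -> bool})
    (s : {perm 'I_n}) (m : mono n) : F :=
  \prod_(i | m.1 i) (-1) ^+ a (s i).

Definition actmx (F : fieldType) (n : nat) (a : {ffun 'I_n -> bool})
    (s : {perm 'I_n}) : 'M[F]_(PN n) :=
  \matrix_(i, j) (if enum_val j == act_mono s (enum_val i)
                  then act_sign F a s (enum_val i) else 0).

(* Irreducible characters of S_n via Specht modules (Young's           *)
(* construction): for the canonical tableau of shape l (filled         *)
(* 0..n-1 row by row), e = sum_{p in R_t} sum_{q in C_t} sgn(q) p q,    *)
(* the Specht module is the left ideal F[S_n] e, and chi_l(s) is the    *)
(* trace of left multiplication by s on it.                             *)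
Fixpoint cell_of (l : seq nat) (m : nat) : nat * nat :=
  match l with
  | [::] => (0%N, m)
  | r :: l' => if (m < r)%N then (0%N, m)
               else let rc := cell_of l' (m - r) in (rc.1.+1, rc.2)
  end.

Definition row_grp (n : nat) (l : seq nat) : {set {perm 'I_n}} :=
  [set p : {perm 'I_n} | [forall i : 'I_n, (cell_of l (p i)).1 == (cell_of l i).1]].
Definition col_grp (n : nat) (l : seq nat) : {set {perm 'I_n}} :=
  [set p : {perm 'I_n} | [forall i : 'I_n, (cell_of l (p i)).2 == (cell_of l i).2]].

Definition NS (n : nat) := #|{: {perm 'I_n}}|.

Definition young_row (F : fieldType) (n : nat) (l : seq nat)
    (g : {perm 'I_n}) : 'rV[F]_(NS n) :=
  \row_(h < NS n) \sum_(p in row_grp n l) \sum_(q in col_grp n l)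
     (if (g * (p * q))%g == enum_val h then (-1) ^+ odd_perm q else 0).

Definition specht_mx (F : fieldType) (n : nat) (l : seq nat) : 'M[F]_(NS n) :=
  \matrix_(i < NS n) young_row F l (enum_val i).

Definition lmul_mx (F : fieldType) (n : nat) (s : {perm 'I_n}) : 'M[F]_(NS n) :=
  \matrix_(i, j) ((s * enum_val i)%g == enum_val j)%:R.

Definition is_partition (n : nat) (l : seq nat) : bool :=
  [&& sumn l == n, sorted geq l & all (fun x => 0 < x)%N l].

Definition specht_char (F : fieldType) (n : nat) (l : seq nat)
    (s : {perm 'I_n}) : F :=
  restr_trace (specht_mx F n l) (lmul_mx F s).

(* chi_{l, emptyset}: irreducible character of Z_2 wr S_n with l |- n *)
(* for the even part and empty partition for the odd part: the          *)
(* inflation of chi_l (the a-components act trivially).  By convention  *)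
(* it is 0 when l is not a partition of n (e.g. hooks (n-j,1^j), j>=n). *)
Definition wchar_empty (F : fieldType) (n : nat) (l : seq nat)
    (a : {ffun 'I_n -> bool}) (s : {perm 'I_n}) : F :=
  if is_partition n l then specht_char F l s else 0.

Definition hook (m j : nat) : seq nat := m :: nseq j 1%N.

(* The Grassmann algebra G_m = <1, e_1..e_m | e_i e_j = - e_j e_i>,     *)
(* realized on its standard basis e_S (S subset of 'I_m, e_S the        *)
(* increasing product):  e_S e_T = (-1)^{#{(s,t) in SxT | s > t}}        *)
(* e_{S u T} if S, T disjoint, and 0 otherwise.                         *)
Notation grass F m := {ffun {set 'I_m} -> F^o}.

Definition gsign (F : fieldType) (m : nat) (S T : {set 'I_m}) : F :=
  if [disjoint S & T] then
    (-1) ^+ #|[set st in setX S T | (st.2 < st.1)%N]|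
  else 0.

Definition gmul (F : fieldType) (m : nat) (x y : grass F m) : grass F m :=
  [ffun U => \sum_(S : {set 'I_m}) \sum_(T : {set 'I_m})
               (if S :|: T == U then x S * y T * gsign F S T else 0)].

Definition gone (F : fieldType) (m : nat) : grass F m :=
  [ffun S => (S == set0)%:R].

Definition gen (F : fieldType) (m : nat) (i : 'I_m) : grass F m :=
  [ffun S => (S == [set i])%:R].

Definition triv0 (F : fieldType) (m : nat) : pred (grass F m) := predT.
Definition triv1 (F : fieldType) (m : nat) : pred (grass F m) := pred1 0.

(* Main.v *)
(* The evaluations of a multilinear polynomial f on G_2k are governed by the numbers
   phi_J(f), J a set of variables: the signed sum of the coefficients of f, where a
   monomial counts with the sign of the order in which it lists J.  Substituting odd
   elements for the variables in J and even (central) ones for the others multiplies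
   phi_J(f) by the product of the substituted elements.  Hence f is an identity iff
   phi_J(f) = 0 for |J| <= 2k, and f is central iff this holds for the odd |J| <= 2k.

   Let V = F^n be the permutation module and w = \sum_a e_a.  The vectors
   (phi_J)_J of the monomials span the exterior powers of V of even degree, and the
   part of odd degree is obtained from the even one by exterior product with w.  So
   P_n / Id is the sum of the Lambda^(2i) V, i <= k, and P_n / C is the sum of the
   w /\ Lambda^(2i) V, i < k.  As multiplication by w is an exact differential,
   Lambda^i V = (w /\ Lambda^i V) + (w /\ Lambda^(i-1) V) on characters, and
   w /\ Lambda^j V is the Specht module of the hook (n-j, 1^j): right multiplication
   by the Young symmetrizer of the hook factors as Lambda^j V -> Lambda^(j+1) V
   through the product with w. *)
Require Import Defs.
From HB Require Import structures.
From mathcomp Require Import all_boot all_order all_algebra all_fingroup.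
Set Warnings "-ambiguous-paths,-notation-overridden".
Set Implicit Arguments. Unset Strict Implicit. Unset Printing Implicit Defensive.
From mathcomp Require Import ring zify.
Import GRing.Theory.
Local Open Scope ring_scope.

(** * Traces on invariant subspaces *)

Section RestrictedTrace.

Variable F : fieldType.

(** The trace does not depend on the basis [row_base] picks: the coordinate matrices [C] and [D]
    between two bases of one space are mutually inverse. *)
Lemma restr_traceE (m N r : nat) (A : 'M[F]_(m, N)) (L : 'M[F]_N)
    (B : 'M[F]_(r, N)) (T : 'M[F]_r) :
  row_free B -> (A :=: B)%MS -> B *m L = T *m B -> restr_trace A L = \tr T.
Proof.
move=> freeB eqAB BL; rewrite /restr_trace.
set R := row_base A.
have freeR : row_free R by apply: row_base_free.
have eqRB : (R :=: B)%MS by apply: (eqmx_trans (eq_row_base A)).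
have /submxP[C defR] : (R <= B)%MS by rewrite eqRB.
have /submxP[D defB] : (B <= R)%MS by rewrite eqRB.
have DC : D *m C = 1%:M.
  by apply: (row_free_inj freeB); rewrite -mulmxA -defR -defB mul1mx.
have BR : B *m pinvmx R = D by rewrite defB mulmxKp.
have -> : R *m L *m pinvmx R = C *m (T *m D).
  by rewrite [X in X *m L]defR -(mulmxA C B L) BL -(mulmxA C) -(mulmxA T) BR.
by rewrite mxtrace_mulC -mulmxA DC mulmx1.
Qed.

Lemma restr_trace_stable (m N : nat) (A : 'M[F]_(m, N)) (L : 'M[F]_N) :
  stablemx A L ->
  row_base A *m L = row_base A *m L *m pinvmx (row_base A) *m row_base A.
Proof.
move=> stA; rewrite mulmxKpV //.
rewrite eq_row_base; apply: submx_trans stA.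
by apply: submxMr; rewrite eq_row_base.
Qed.

Lemma restr_trace_eqmx (m m' N : nat) (A : 'M[F]_(m, N)) (B : 'M[F]_(m', N))
    (L : 'M[F]_N) :
  (A :=: B)%MS -> stablemx B L -> restr_trace A L = restr_trace B L.
Proof.
move=> eqAB /restr_trace_stable; apply: restr_traceE; first exact: row_base_free.
by apply: (eqmx_trans eqAB); apply: eqmx_sym; apply: eq_row_base.
Qed.

(** For an idempotent [col_base Q *m row_base Q], the product in the opposite order is the identity;
    cyclicity of the trace does the rest. *)
Lemma restr_trace_idem (N : nat) (Q L : 'M[F]_N) :
  Q *m Q = Q -> stablemx Q L -> restr_trace Q L = \tr (Q *m L).
Proof.
move=> QQ stQ; have BX : row_base Q *m col_base Q = 1%:M.
  move: (mulmx_base Q) (row_base_free Q) (col_base_full Q).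
  move: (col_base Q) (row_base Q) => X B XB freeB fullX.
  apply: (row_free_inj freeB); apply: (row_full_inj fullX).
  by rewrite mul1mx !mulmxA XB -mulmxA XB.
rewrite -[Q in RHS](mulmx_base Q) -mulmxA restr_trace_stable // /restr_trace.
by rewrite [RHS]mxtrace_mulC -(mulmxA _ (row_base Q)) BX mulmx1.
Qed.

Lemma mxrank_idem (N : nat) (Q : 'M[F]_N) : Q *m Q = Q -> (\rank Q)%:R = \tr Q.
Proof.
move=> QQ; rewrite -[Q in RHS]mulmx1 -restr_trace_idem //; last first.
  by rewrite mulmx1.
by rewrite /restr_trace mulmx1 mulmxVp ?row_base_free // mxtrace1.
Qed.

(** [K'] undoes [K] on the row space of [A], so [K] identifies that space with its image and carries
    [L] to [L']. *)
Lemma restr_trace_inj (m N M : nat) (A : 'M[F]_(m, N)) (K : 'M[F]_(N, M))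
    (K' : 'M[F]_(M, N)) (L : 'M[F]_N) (L' : 'M[F]_M) :
  A *m K *m K' = A -> stablemx A L -> L *m K = K *m L' ->
  restr_trace (A *m K) L' = restr_trace A L.
Proof.
move=> AKK' stA LK.
have RKK' : row_base A *m K *m K' = row_base A.
  have /submxP[C ->] : (row_base A <= A)%MS by rewrite eq_row_base.
  by rewrite -!(mulmxA C) AKK'.
apply: (restr_traceE (B := row_base A *m K)).
- apply/row_freeP; exists (K' *m pinvmx (row_base A)).
  by rewrite (mulmxA _ K') RKK' mulmxVp ?row_base_free.
- by apply: eqmxMr; apply: eqmx_sym; apply: eq_row_base.
- rewrite -(mulmxA (row_base A) K) -LK (mulmxA (row_base A) L).
  by rewrite [X in X *m K = _](restr_trace_stable stA) -[LHS]mulmxA.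
Qed.

Lemma stablemx_kermx (N M : nat) (E : 'M[F]_(N, M)) (L : 'M[F]_N) (L' : 'M[F]_M) :
  L *m E = E *m L' -> stablemx (kermx E) L.
Proof.
by move=> LE; apply/sub_kermxP; rewrite -mulmxA LE mulmxA mulmx_ker mul0mx.
Qed.

(* The image of E is the quotient by the kernel: the trace is additive. *)
Lemma trace_ker_im (N M : nat) (E : 'M[F]_(N, M)) (L : 'M[F]_N) (L' : 'M[F]_M) :
  L *m E = E *m L' ->
  \tr L = restr_trace (kermx E) L + restr_trace E L'.
Proof.
move=> LE; have stE : stablemx E L' by rewrite -LE submxMl.
pose X := col_base E; pose B := row_base E; pose W := row_base (kermx E).
have XB : X *m B = E by apply: mulmx_base.
have BL' := restr_trace_stable stE.
have WL := restr_trace_stable (stablemx_kermx LE).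
rewrite /restr_trace -/B -/W; rewrite -/B in BL'; rewrite -/W in WL.
set T := B *m _ *m _; set T' := W *m _ *m _.
rewrite -/T in BL'; rewrite -/T' in WL.
have freeB : row_free B by apply: row_base_free.
have freeW : row_free W by apply: row_base_free.
have kerW : (W :=: kermx E)%MS by apply: eq_row_base.
have [X' X'X] := row_fullP (col_base_full E); rewrite -/X in X'X.
clearbody T T' X B W.
have LX : L *m X = X *m T.
  by apply: (row_free_inj freeB); rewrite -!mulmxA XB -BL' mulmxA XB.
(* [X *m X'] is a projection along the kernel of [E], so its complement factors through the basis
   [W] of that kernel. *)
have /submxP[C defW'] : (1%:M - X *m X' <= W)%MS.
  rewrite kerW; apply/sub_kermxP.
  rewrite -[Y in _ *m Y]XB mulmxA mulmxBl mul1mx -(mulmxA X X' X) X'X mulmx1.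
  by rewrite subrr mul0mx.
have WX : W *m X = 0.
  apply: (row_free_inj freeB); rewrite mul0mx -mulmxA XB.
  by apply/sub_kermxP; rewrite kerW.
have WC : W *m C = 1%:M.
  apply: (row_free_inj freeW); rewrite mul1mx -mulmxA -defW'.
  by rewrite mulmxBr mulmx1 mulmxA WX mul0mx subr0.
have -> : L = L *m C *m W + L *m X *m X'.
  by rewrite -!mulmxA -mulmxDr -defW' subrK mulmx1.
rewrite mxtraceD (mxtrace_mulC _ W) (mulmxA W) WL -(mulmxA T') WC mulmx1.
by rewrite LX (mxtrace_mulC _ X') mulmxA X'X mul1mx.
Qed.

End RestrictedTrace.

(** * Matrices indexed by finite types *)

Section FunctionMatrix.

Variable F : fieldType.

Definition fmx (I J : finType) (M : I -> J -> F) : 'M[F]_(#|I|, #|J|) :=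
  \matrix_(i, j) M (enum_val i) (enum_val j).

Lemma fmxE (I J : finType) (M : I -> J -> F) (i : I) (j : J) :
  fmx M (enum_rank i) (enum_rank j) = M i j.
Proof. by rewrite mxE !enum_rankK. Qed.

Lemma matrix_rankP (I J : finType) (A B : 'M[F]_(#|I|, #|J|)) :
  (forall i j, A (enum_rank i) (enum_rank j) = B (enum_rank i) (enum_rank j)) ->
  A = B.
Proof.
move=> eqAB; apply/matrixP=> i j.
by have := eqAB (enum_val i) (enum_val j); rewrite !enum_valK.
Qed.

Lemma eq_fmx (I J : finType) (M M' : I -> J -> F) :
  (forall i j, M i j = M' i j) -> fmx M = fmx M'.
Proof. by move=> eqM; apply/matrixP=> i j; rewrite !mxE eqM. Qed.

Lemma sum_enum_rank (I : finType) (G : 'I_#|I| -> F) :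
  \sum_i G i = \sum_(x : I) G (enum_rank x).
Proof. by rewrite (reindex enum_rank) //; apply/onW_bij/enum_rank_bij. Qed.

Lemma fmxM (I J K : finType) (M : I -> J -> F) (M' : J -> K -> F) :
  fmx M *m fmx M' = fmx (fun i k => \sum_j M i j * M' j k).
Proof.
apply: matrix_rankP => i k; rewrite mxE fmxE sum_enum_rank.
by apply: eq_bigr => j _; rewrite !fmxE.
Qed.

Lemma fmxD (I J : finType) (M M' : I -> J -> F) :
  fmx M + fmx M' = fmx (fun i j => M i j + M' i j).
Proof. by apply/matrixP=> i j; rewrite !mxE. Qed.

Lemma fmx1 (I : finType) : fmx (fun i j : I => (i == j)%:R) = 1%:M.
Proof. by apply/matrixP=> i j; rewrite !mxE (inj_eq enum_val_inj). Qed.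

Lemma tr_fmx (I : finType) (M : I -> I -> F) : \tr (fmx M) = \sum_i M i i.
Proof. by rewrite /mxtrace sum_enum_rank; apply: eq_bigr => i _; rewrite fmxE. Qed.

Lemma fmx_trans (I J : finType) (M : I -> J -> F) :
  (fmx M)^T = fmx (fun j i => M i j).
Proof. by apply/matrixP=> i j; rewrite !mxE. Qed.

End FunctionMatrix.

(** * Signs in the exterior algebra *)

Lemma set_ind_card (T : finType) (P : {set T} -> Prop) :
  P set0 -> (forall a (K : {set T}), a \notin K -> P K -> P (a |: K)) -> forall J, P J.
Proof.
move=> P0 PU J; have [m] := ubnP #|J|; elim: m J => // m IHm J.
have [->//|[a aJ]] := set_0Vmem J.
rewrite (cardsD1 a) aJ ltnS => leJm; rewrite -(setD1K aJ).
by apply: PU; [rewrite !inE eqxx | apply: IHm].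
Qed.

Section PairProduct.

Variables (F : fieldType) (n : nat).
Implicit Types (J K : {set 'I_n}) (G : 'I_n -> 'I_n -> F) (s : {perm 'I_n}).

(** The sign of a permutation on a subset and the sign of a product of Grassmann basis elements are
    both products of this form. *)
Definition pairprod J G : F := \prod_(a in J) \prod_(b in J | (a < b)%N) G a b.

Lemma eq_pairprod J G G' :
  (forall a b, a \in J -> b \in J -> (a < b)%N -> G a b = G' a b) ->
  pairprod J G = pairprod J G'.
Proof.
by move=> eqG; apply: eq_bigr => a aJ; apply: eq_bigr => b /andP[bJ ab]; apply: eqG.
Qed.

Lemma pairprodM J G G' :
  pairprod J (fun a b => G a b * G' a b) = pairprod J G * pairprod J G'.
Proof. by rewrite -big_split; apply: eq_bigr => a _; rewrite big_split. Qed.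

Lemma pairprod0 G : pairprod set0 G = 1.
Proof. by rewrite /pairprod big_set0. Qed.

Lemma pairprodU1 a K G : a \notin K ->
  pairprod (a |: K) G =
  pairprod K G * \prod_(b in K) (if (a < b)%N then G a b else G b a).
Proof.
move=> aK; rewrite /pairprod big_setU1 //=.
have -> : \prod_(b in a |: K | (a < b)%N) G a b
        = \prod_(b in K) (if (a < b)%N then G a b else 1).
  by rewrite big_mkcondr big_setU1 //= ltnn mul1r.
under [X in _ * X]eq_bigr => b bK do rewrite big_mkcondr big_setU1 //= -big_mkcondr.
rewrite [X in _ * X]big_split /= mulrA mulrC; congr (_ * _).
rewrite -[LHS]big_split; apply: eq_bigr => b bK /=.
have : (b != a :> nat) by apply: contraNneq aK => /val_inj <-.
by case: ltngtP => // _ _; rewrite ?mulr1 ?mul1r.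
Qed.

(** For symmetric [G] the product runs over unordered pairs, which a permutation merely relabels. *)
Lemma pairprod_perm J G s : (forall a b, G a b = G b a) ->
  pairprod J (fun a b => G (s a) (s b)) = pairprod (s @: J) G.
Proof.
move=> symG; elim/set_ind_card: J => [|a K aK IHK].
  by rewrite imset0 !pairprod0.
have saK : s a \notin s @: K by rewrite mem_imset //; apply: perm_inj.
rewrite imsetU1 !pairprodU1 // IHK big_imset /=; last by move=> x y _ _; apply: perm_inj.
by congr (_ * _); apply: eq_bigr => b _; rewrite symG if_same [in RHS]symG if_same.
Qed.

End PairProduct.

Section ExteriorSigns.

Variables (F : fieldType) (n : nat).
Implicit Types (J K : {set 'I_n}) (s t : {perm 'I_n}) (a b : 'I_n).

(** The sign from sorting e_a /\ e_b. The diagonal value [-1] keeps [sgo2] free of side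
    conditions. *)
Definition sgo (a b : nat) : F := if (a < b)%N then 1 else -1.

Lemma sgo_lt (a b : nat) : (a < b)%N -> sgo a b = 1.
Proof. by rewrite /sgo => ->. Qed.

Lemma sgoC (a b : nat) : a != b -> sgo a b = - sgo b a.
Proof. by rewrite /sgo; case: ltngtP => // _ _; rewrite opprK. Qed.

Lemma sgo2 (a b : nat) : sgo a b * sgo a b = 1.
Proof. by rewrite /sgo; case: ifP; rewrite ?mulrNN mulr1. Qed.

(* The sign with which s carries the basis element e_J to e_(s J). *)
Definition eta s J : F := pairprod J (fun a b => sgo (s a) (s b)).

(* The sign in e_a /\ e_K = kappa a K e_(a |: K), a \notin K. *)
Definition kappa (a : 'I_n) K : F := \prod_(b in K) sgo a b.

Lemma kappa2 a K : kappa a K * kappa a K = 1.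
Proof. by rewrite -big_split big1 // => b _; apply: sgo2. Qed.

Lemma kappaU1 a b K : b \notin K -> kappa a (b |: K) = sgo a b * kappa a K.
Proof. by move=> bK; rewrite /kappa big_setU1. Qed.

Lemma eta0 s : eta s set0 = 1. Proof. exact: pairprod0. Qed.

Lemma eta1 J : eta 1%g J = 1.
Proof.
rewrite /eta /pairprod big1 // => a _; rewrite big1 // => b /andP[_ ab].
by rewrite !perm1 sgo_lt.
Qed.

(** The factor [sgo (s a) (s b)] of [eta] is not symmetric. Multiplying by [sgo a b] makes it so
    without changing it on increasing pairs, and [pairprod_perm] becomes applicable. *)
Definition sgo_defect s a b : F := if a == b then 1 else sgo a b * sgo (s a) (s b).

Lemma sgo_defectC s a b : sgo_defect s a b = sgo_defect s b a.
Proof.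
rewrite /sgo_defect eq_sym; case: eqP => // /eqP ba.
by rewrite sgoC 1?eq_sym // [sgo (s a) _]sgoC ?mulrNN // (inj_eq val_inj)
  (inj_eq perm_inj) eq_sym.
Qed.

Lemma eta_defect s J : eta s J = pairprod J (sgo_defect s).
Proof.
apply: eq_pairprod => a b _ _ ab.
by rewrite /sgo_defect -(inj_eq val_inj) (ltn_eqF ab) (sgo_lt ab) mul1r.
Qed.

Lemma etaU1 s a K : a \notin K ->
  eta s (a |: K) = eta s K * \prod_(b in K) (sgo a b * sgo (s a) (s b)).
Proof.
move=> aK; rewrite !eta_defect pairprodU1 //; congr (_ * _).
apply: eq_bigr => b bK; rewrite [sgo_defect s b a]sgo_defectC if_same.
by rewrite /sgo_defect; case: eqP => // ab; rewrite ab bK in aK.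
Qed.

(** The cocycle identity behind [rhoM]. The symmetric defect of [t] is relabelled along [s], after
    which the signs of [s] cancel pair by pair. *)
Lemma etaM s t J : eta (s * t)%g J = eta s J * eta t (s @: J).
Proof.
rewrite [eta t _]eta_defect -(pairprod_perm _ _ (sgo_defectC t)) -pairprodM.
apply: eq_pairprod => a b _ _ ab; rewrite /sgo_defect !permM (inj_eq perm_inj).
by rewrite -(inj_eq val_inj) (ltn_eqF ab) mulrA sgo2 mul1r.
Qed.

Lemma imset_permM s t J : (s * t)%g @: J = t @: (s @: J).
Proof. by rewrite -imset_comp; apply: eq_imset => x; rewrite permM. Qed.

Lemma imset_perm1 J : (1%g : {perm 'I_n}) @: J = J.
Proof. by rewrite (eq_imset _ (@perm1 _)) imset_id. Qed.

Lemma imset_permV s J K : (K == s @: J) = (J == s^-1%g @: K).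
Proof.
by apply/eqP/eqP => ->; rewrite -imset_permM ?mulgV ?mulVg imset_perm1.
Qed.

Lemma eta_sqr s J : eta s J * eta s J = 1.
Proof.
rewrite /eta -pairprodM /pairprod big1 // => a _.
by rewrite big1 // => b _; rewrite sgo2.
Qed.

Lemma etaV s J : eta s^-1%g (s @: J) = eta s J.
Proof.
have : eta s J * eta s^-1%g (s @: J) = 1 by rewrite -etaM mulgV eta1.
by move/(congr1 ( *%R (eta s J))); rewrite mulrA eta_sqr mul1r mulr1.
Qed.

(** Applying [s] to e_a /\ e_K before or after sorting gives the same sign; this is the equivariance
    of [wedge]. *)
Lemma kappa_eta s a K : a \notin K ->
  kappa a K * eta s (a |: K) = eta s K * kappa (s a) (s @: K).
Proof.
move=> aK; rewrite etaU1 // mulrCA; congr (_ * _).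
rewrite /kappa big_imset /=; last by move=> x y _ _; apply: perm_inj.
by rewrite -big_split; apply: eq_bigr => b _ /=; rewrite mulrA sgo2 mul1r.
Qed.

Lemma tperm_notin (a b c : 'I_n) J : a \notin J -> b \notin J -> c \in J ->
  tperm a b c = c.
Proof. by move=> aJ bJ cJ; apply: tpermD; apply: contraTneq cJ => <-. Qed.

Lemma eta_id s J : {in J, forall a, s a = a} -> eta s J = 1.
Proof.
move=> idJ; rewrite -[RHS](eta1 J); apply: eq_pairprod => a b aJ bJ _.
by rewrite !idJ // !perm1.
Qed.

(** The signs involving a third element of [J] cancel, and only the exchanged pair remains. *)
Lemma eta_tperm a b J : a != b -> a \in J -> b \in J -> eta (tperm a b) J = -1.
Proof.
move=> ab aJ bJ; pose K := J :\ a :\ b.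
have bK : b \notin K by rewrite !inE eqxx.
have aK : a \notin b |: K by rewrite !inE eqxx andbF orbF.
have defJ : J = a |: (b |: K) by rewrite setD1K ?setD1K // !inE eq_sym ab.
have aK' : a \notin K by apply: contra aK; apply: setU1r.
have idK : {in K, forall c, tperm a b c = c} by move=> c; apply: tperm_notin.
rewrite defJ !etaU1 // eta_id // mul1r big_setU1 //= tpermL tpermR.
rewrite mulrCA -big_split /= big1 => [|c cK]; last first.
  by rewrite (idK c cK) [_ * sgo a c]mulrC mulrACA !sgo2 mulr1.
by rewrite mulr1 [sgo b a]sgoC ?mulrN ?sgo2 // eq_sym.
Qed.

Lemma eta_perm_on s J : perm_on J s -> eta s J = (-1) ^+ odd_perm s.
Proof.
have [m] := ubnP #|J|; elim: m J s => // m IHm J s ltJm onJ.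
have [J0|[a aJ]] := set_0Vmem J.
  rewrite J0 eta0; have -> : s = 1%g; last by rewrite odd_perm1.
  apply/permP=> x; rewrite perm1; apply/eqP; apply: contraTT isT => sx.
  by have := subsetP onJ x sx; rewrite J0 inE.
have saJ : s a \in J by rewrite perm_closed.
(* With this [t] the product [(s * t)%g] fixes [a], so the induction hypothesis applies to it on
   [J :\ a]. *)
pose t := tperm a (s a); have onJt : perm_on J t.
  apply/subsetP=> x; rewrite inE; apply: contraNT => xJ.
  by rewrite tpermD //; apply: contraNneq xJ => <-.
have st_a : (s * t)%g a = a by rewrite permM tpermR.
have onK : perm_on (J :\ a) (s * t)%g.
  apply/subsetP=> x xst; rewrite !inE; apply/andP; split.
    by apply: contraNneq xst => ->; rewrite st_a.
  by apply: (subsetP (perm_onM onJ onJt)).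
have /(IHm (J :\ a)) /(_ onK) IH: (#|J :\ a| < m)%N.
  by move: ltJm; rewrite (cardsD1 a) aJ ltnS.
have eta_st : eta (s * t)%g J = (-1) ^+ odd_perm (s * t)%g.
  rewrite -(setD1K aJ) etaU1 ?IH ?inE ?eqxx // -[RHS]mulr1; congr (_ * _).
  rewrite st_a big_split /= -[X in _ * X](big_imset (fun b => sgo a b)) /=; last first.
    by move=> x y _ _; apply: perm_inj.
  by rewrite im_perm_on // kappa2.
have imJ : s @: J = J by apply: im_perm_on.
move: eta_st; rewrite etaM imJ odd_permM odd_tperm; case: eqP => [as_|/eqP as_] /=.
  by rewrite addbF /t -as_ tperm1 eta1 mulr1.
rewrite (eta_tperm as_) // mulrN1 addbT => /eqP.
by case: odd_perm => /=; rewrite eqr_oppLR ?expr0 ?opprK => /eqP.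
Qed.

End ExteriorSigns.

(** * The permutation action and the differential on the exterior algebra *)

Section ExteriorMatrices.

Variables (F : fieldType) (n : nat).
Implicit Types (J K : {set 'I_n}) (s t : {perm 'I_n}) (a b : 'I_n) (P : pred nat).

Lemma sum_delta (I : finType) (x : I) (c : I -> F) :
  \sum_i (i == x)%:R * c i = c x.
Proof.
rewrite (bigD1 x) //= eqxx mul1r big1 ?addr0 // => i /negbTE->.
by rewrite mul0r.
Qed.

(** The action on the exterior algebra in the basis e_J; vectors are rows, which matches the order
    of composition of permutations. *)
Definition rho s := fmx (fun J K => (K == s @: J)%:R * eta F s J).

Definition wedge_coef J K : F :=
  \sum_a (a \notin J)%:R * ((K == a |: J)%:R * kappa F a J).

(* Left multiplication by the invariant vector \sum_a e_a of the exterior algebra. *)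
Definition wedge := fmx wedge_coef.

Definition degp P := fmx (fun J K => (K == J)%:R * (P #|J|)%:R : F).

Lemma rhoM s t : rho (s * t)%g = rho s *m rho t.
Proof.
rewrite fmxM; apply: eq_fmx => J K.
under [RHS]eq_bigr => J' _ do rewrite -mulrA.
by rewrite sum_delta mulrCA imset_permM etaM.
Qed.

Lemma rho1 : rho 1%g = 1%:M.
Proof.
by rewrite -fmx1; apply: eq_fmx => J K; rewrite imset_perm1 eta1 mulr1 eq_sym.
Qed.

Lemma trmx_rho s : (rho s)^T = rho s^-1%g.
Proof.
rewrite fmx_trans; apply: eq_fmx => K J; rewrite imset_permV; case: eqP => [->|].
  by rewrite -[in RHS]etaV invgK.
by rewrite !mul0r.
Qed.

Lemma rho_wedge s : rho s *m wedge = wedge *m rho s.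
Proof.
rewrite !fmxM; apply: eq_fmx => J K; rewrite /wedge_coef.
under eq_bigr => J' _ do rewrite -mulrA.
rewrite sum_delta mulr_sumr (reindex_inj (@perm_inj _ s)) /=.
under [RHS]eq_bigr => J' _ do rewrite mulr_suml.
rewrite exchange_big; apply: eq_bigr => a _ /=.
rewrite mem_imset; last exact: perm_inj.
have [aJ|aJ] := boolP (a \in J).
  by rewrite mul0r mulr0 big1 // => J' _; rewrite !mul0r.
under eq_bigr => J' _ do rewrite mul1r -mulrA.
by rewrite sum_delta imsetU1 mul1r mulrCA -kappa_eta // mulrCA.
Qed.

Lemma mul_degp P (I : finType) (M : {set 'I_n} -> I -> F) :
  degp P *m fmx M = fmx (fun J x => (P #|J|)%:R * M J x).
Proof.
rewrite fmxM; apply: eq_fmx => J x.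
by under eq_bigr => J1 _ do rewrite -mulrA; rewrite sum_delta.
Qed.

Lemma mul_degpr P (I : finType) (M : I -> {set 'I_n} -> F) :
  fmx M *m degp P = fmx (fun x K => M x K * (P #|K|)%:R).
Proof.
rewrite fmxM; apply: eq_fmx => x K.
under eq_bigr => J1 _ do rewrite eq_sym mulrCA.
by rewrite sum_delta.
Qed.

Lemma eq_degp P P' : P =1 P' -> degp P = degp P'.
Proof. by move=> eqP; apply: eq_fmx => J K; rewrite eqP. Qed.

Lemma degpM P P' : degp P *m degp P' = degp (predI P P').
Proof.
rewrite mul_degp; apply: eq_fmx => J K.
by rewrite mulrCA; congr (_ * _); rewrite -natrM mulnb.
Qed.

Lemma degp_rho P s : degp P *m rho s = rho s *m degp P.
Proof.
rewrite mul_degp mul_degpr; apply: eq_fmx => J K; rewrite mulrC.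
case: eqP => [->|]; last by rewrite !mul0r.
by rewrite card_imset //; apply: perm_inj.
Qed.

Lemma degp_wedge P : degp (P \o succn) *m wedge = wedge *m degp P.
Proof.
rewrite mul_degp mul_degpr; apply: eq_fmx => J K.
rewrite mulr_sumr mulr_suml; apply: eq_bigr => a _.
have [aJ|aJ] := boolP (a \in J); first by rewrite !mul0r mulr0.
rewrite mul1r mulrC; case: eqP => [->|]; last by rewrite !mul0r.
by rewrite cardsU1 aJ.
Qed.

(** Exchanging the two inserted indices changes the sign, so each entry equals its own negative. *)
Lemma wedge2 : 2%:R != 0 :> F -> wedge *m wedge = 0.
Proof.
move=> nz2; apply: matrix_rankP => J K; rewrite fmxM fmxE mxE.
pose T a b : F := (a \notin J)%:R * kappa F a J *
  ((b \notin a |: J)%:R * ((K == b |: (a |: J))%:R * kappa F b (a |: J))).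
have -> : \sum_J' wedge_coef J J' * wedge_coef J' K = \sum_a \sum_b T a b.
  rewrite /T; under eq_bigr => J' _ do rewrite {1}/wedge_coef mulr_suml.
  rewrite exchange_big; apply: eq_bigr => a _ /=.
  rewrite -mulr_sumr -/(wedge_coef (a |: J) K).
  under eq_bigr => J' _ do rewrite mulrCA -!mulrA.
  by rewrite sum_delta mulrA.
have TC a b : T a b = - T b a.
  rewrite /T !inE !negb_or [b == a]eq_sym.
  have [|aJ] := boolP (a \in J); first by rewrite andbF !mul0r ?mulr0 oppr0.
  have [|bJ] := boolP (b \in J); first by rewrite andbF !mul0r ?mulr0 oppr0.
  have [|ab] := eqVneq a b; first by rewrite /= !mul0r !mulr0 oppr0.
  rewrite /= !mul1r [b |: (a |: J)]setUCA !kappaU1 //.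
  by rewrite [sgo F b a]sgoC 1?eq_sym //; ring.
have S0 : \sum_a \sum_b T a b = - (\sum_a \sum_b T a b).
  rewrite -sumrN [LHS]exchange_big; apply: eq_bigr => b _ /=.
  by rewrite -sumrN; apply: eq_bigr => a _; apply: TC.
apply/eqP; rewrite -(inj_eq (mulfI nz2)) mulr0 mulr_natl mulr2n.
by rewrite {2}S0 subrr.
Qed.

Lemma mxtrace_degp (j : nat) : \tr (degp (pred1 j)) = 'C(n, j)%:R.
Proof.
rewrite tr_fmx; under eq_bigr => J _ do rewrite eqxx mul1r.
by rewrite -natr_sum -big_mkcond sum1dep_card -[in RHS](card_ord n) -card_draws.
Qed.

End ExteriorMatrices.

(** * Exactness of the product with w and the characters of its image *)

Section Contraction.

Variables (F : fieldType) (n : nat).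
Hypothesis nz2 : 2%:R != 0 :> F.
Implicit Types (J K : {set 'I_n.+1}) (s : {perm 'I_n.+1}) (P : pred nat).

Local Notation wedge := (wedge F n.+1).

(* Contraction with the first coordinate: a homotopy for wedge. *)
Definition contr : 'M[F]_(_, _) :=
  fmx (fun J K => (K == J :\ ord0)%:R * (ord0 \in J)%:R).

Lemma kappa_ord0 K : kappa F ord0 (K :\ ord0) = 1.
Proof.
by rewrite /kappa big1 // => b; rewrite !inE => /andP[b0 _]; rewrite sgo_lt ?lt0n.
Qed.

(** The homotopy formula: contraction is an antiderivation, and the vector \sum_a e_a has first
    coordinate 1. *)
Lemma wedge_contr : wedge *m contr + contr *m wedge = 1%:M.
Proof.
rewrite -fmx1 !fmxM fmxD; apply: eq_fmx => J K.
under eq_bigr => J' _ do rewrite /wedge_coef mulr_suml.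
rewrite exchange_big /=.
rewrite (eq_bigr (fun a => (a \notin J)%:R * (kappa F a J *
    ((K == (a |: J) :\ ord0)%:R * (ord0 \in a |: J)%:R)))); last first.
  move=> a _; under eq_bigr => J' _ do rewrite -mulrA -mulrA mulrCA.
  by rewrite sum_delta mulrCA.
under [X in _ + X]eq_bigr => J' _ do rewrite -mulrA.
rewrite sum_delta.
(* Without [ord0] in [J], only inserting and then removing [ord0] survives. With it, the terms for
   [a] outside [J] cancel, as [a] passes [ord0] in just one of the two composites, and reinserting
   [ord0] returns [J]. *)
have [J0|J0] := boolP (ord0 \in J); last first.
  rewrite mul0r addr0 (bigD1 ord0) //= big1 => [|a a0]; last first.
    by rewrite !inE (negbTE J0) orbF [ord0 == a]eq_sym (negbTE a0) !mulr0.
  have J0E : J :\ ord0 = J.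
    by apply/setP=> x; rewrite !inE; case: eqP => // ->; rewrite (negbTE J0).
  rewrite -{2}J0E kappa_ord0 setU1K // !inE eqxx J0 !mul1r mulr1 addr0.
  by rewrite eq_sym.
rewrite mul1r; set L := J :\ ord0.
have JE : J = ord0 |: L by rewrite setD1K.
have L0 : ord0 \notin L by rewrite !inE eqxx.
rewrite /wedge_coef (bigD1 ord0) //= J0 mul0r add0r.
rewrite [X in _ + X](bigD1 ord0) //= L0 -JE /L kappa_ord0 mul1r mulr1 -/L.
rewrite addrCA -big_split big1 /= ?addr0 1?eq_sym // => a a0.
have [aJ|aJ] := boolP (a \in J); first by rewrite !inE a0 aJ !mul0r addr0.
rewrite !inE (negbTE aJ) andbF J0 orbT !mul1r mulr1.
have -> : (a |: J) :\ ord0 = a |: L.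
  by apply/setP=> x; rewrite !inE andb_orr; case: (eqVneq x a) => [->|_]; rewrite ?a0 ?andbF.
rewrite JE kappaU1 // sgoC // mulNr sgo_lt ?lt0n // mul1r mulrC mulrN.
by rewrite addNr.
Qed.

Lemma degp_contr P : degp F _ P *m contr = contr *m degp F _ (P \o succn).
Proof.
rewrite mul_degp mul_degpr; apply: eq_fmx => J K; rewrite mulrC.
case: eqP => [->|]; last by rewrite !mul0r.
have [J0|J0] := boolP (ord0 \in J); last by rewrite mulr0 !mul0r.
by rewrite [in LHS](cardsD1 ord0 J) J0.
Qed.

Lemma wedge_contr_wedge : wedge *m contr *m wedge = wedge.
Proof.
rewrite -[RHS]mul1mx -wedge_contr mulmxDl -[X in _ + X]mulmxA.
by rewrite wedge2 // mulmx0 addr0.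
Qed.

(** An idempotent onto the products with w whose degree satisfies [P]. The degree is counted after
    the multiplication, so [pred1 j.+1] describes w /\ Lambda^j. *)
Definition wedge_proj P := degp F _ P *m contr *m wedge.

Lemma wedge_projE P : wedge_proj P = contr *m wedge *m degp F _ P.
Proof. by rewrite /wedge_proj degp_contr -[RHS]mulmxA -degp_wedge mulmxA. Qed.

Lemma wedge_proj_idem P : wedge_proj P *m wedge_proj P = wedge_proj P.
Proof.
have pp : degp F n.+1 P *m degp F n.+1 P = degp F n.+1 P.
  by rewrite degpM; apply: eq_degp => j /=; rewrite andbb.
have := wedge_projE P; have := wedge_contr_wedge; move: pp; rewrite /wedge_proj.
move: (degp F _ P) contr wedge => p c w pp wcw pcw.
by rewrite {1}pcw !mulmxA -(mulmxA _ p p) pp -pcw -!mulmxA (mulmxA w) wcw.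
Qed.

Lemma wedge_proj_eqmx P : (degp F _ (P \o succn) *m wedge :=: wedge_proj P)%MS.
Proof.
apply/eqmxP/andP; split; last first.
  by rewrite /wedge_proj degp_contr -mulmxA submxMl.
rewrite degp_wedge -wedge_contr_wedge -!mulmxA (mulmxA contr) -wedge_projE.
exact: submxMl.
Qed.

Lemma wedge_proj_stable P s : stablemx (wedge_proj P) (rho F s).
Proof.
rewrite -(eqmx_stable _ (wedge_proj_eqmx P)).
by rewrite -mulmxA -rho_wedge mulmxA degp_rho -mulmxA submxMl.
Qed.

Definition wedge_char P s := \tr (wedge_proj P *m rho F s).

Lemma restr_trace_wedge_proj P s :
  restr_trace (wedge_proj P) (rho F s) = wedge_char P s.
Proof. exact: restr_trace_idem (wedge_proj_idem P) (wedge_proj_stable P s). Qed.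

(** Split the identity by [wedge_contr]; in the first summand cyclicity and equivariance move
    [wedge] to the other side. For [P := pred1 i.+1] this decomposes Lambda^i into w /\ Lambda^i and
    w /\ Lambda^(i-1). *)
Lemma mxtrace_degp_rho P s :
  \tr (degp F _ (P \o succn) *m rho F s)
  = wedge_char P s + wedge_char (P \o succn) s.
Proof.
rewrite -[degp F _ _]mulmx1 -wedge_contr mulmxDr mulmxDl mxtraceD.
congr (_ + _); last by rewrite mulmxA.
rewrite mulmxA degp_wedge -!mulmxA mxtrace_mulC -!mulmxA.
by rewrite rho_wedge /wedge_char /wedge_proj !mulmxA.
Qed.

Lemma wedge_char0 P s : P =1 pred1 0%N -> wedge_char P s = 0.
Proof.
move=> P0; rewrite /wedge_char /wedge_proj degp_contr.
have -> : degp F n.+1 (P \o succn) = 0.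
  apply: matrix_rankP => J K; rewrite fmxE mxE /= P0.
  by rewrite mulr0.
by rewrite mulmx0 !mul0mx mxtrace0.
Qed.

Lemma eq_wedge_char P P' s : P =1 P' -> wedge_char P s = wedge_char P' s.
Proof. by move=> eqP; rewrite /wedge_char /wedge_proj (eq_degp _ _ eqP). Qed.

Lemma mxtrace_degp_rho0 s :
  \tr (degp F _ (pred1 0%N) *m rho F s) = wedge_char (pred1 1%N) s.
Proof.
rewrite -(eq_degp F n.+1 (P := pred1 1%N \o succn)) // mxtrace_degp_rho.
by rewrite [X in _ + X]wedge_char0 ?addr0.
Qed.

Lemma mxtrace_degp_rhoS j s :
  \tr (degp F _ (pred1 j.+1) *m rho F s)
  = wedge_char (pred1 j.+2) s + wedge_char (pred1 j.+1) s.
Proof.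
rewrite -(eq_degp F n.+1 (P := pred1 j.+2 \o succn)) // mxtrace_degp_rho.
by congr (_ + _); apply: eq_wedge_char.
Qed.

(** Signed permutation matrices are orthogonal, so transposition gives the claim for exterior
    powers; the recursion transfers it. *)
Lemma wedge_charV j s :
  wedge_char (pred1 j.+1) s^-1%g = wedge_char (pred1 j.+1) s.
Proof.
have trV i : \tr (degp F n.+1 (pred1 i) *m rho F s^-1%g)
           = \tr (degp F n.+1 (pred1 i) *m rho F s).
  rewrite -mxtrace_tr trmx_mul trmx_rho invgK mxtrace_mulC.
  congr (\tr (_ *m _)); rewrite fmx_trans; apply: eq_fmx => J K.
  by rewrite eq_sym; case: eqP => [->|]; rewrite ?mul0r.
elim: j => [|j IHj]; first by have := trV 0%N; rewrite !mxtrace_degp_rho0.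
by have := trV j.+1; rewrite !mxtrace_degp_rhoS IHj => /addIr.
Qed.

(** The recursion at the identity is Pascal's rule. *)
Lemma wedge_char1 j : wedge_char (pred1 j.+1) 1%g = 'C(n, j)%:R.
Proof.
elim: j => [|j IHj].
  by rewrite -mxtrace_degp_rho0 rho1 mulmx1 mxtrace_degp !bin0.
have := mxtrace_degp_rhoS j 1%g; rewrite rho1 mulmx1 mxtrace_degp IHj binS natrD.
by move/addIr.
Qed.

End Contraction.

(** * The signed coefficient sums of multilinear polynomials *)

Lemma perm_imset_card (T : finType) (J K : {set T}) :
  #|J| = #|K| -> exists s : {perm T}, s @: J = K.
Proof.
elim/set_ind_card: J K => [|a L aL IH] K.
  by rewrite cards0 => /esym/eqP; rewrite cards_eq0 => /eqP->; exists 1%g; rewrite imset0.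
have [->|[b bK]] := set_0Vmem K; first by rewrite cardsU1 aL cards0.
rewrite cardsU1 aL (cardsD1 b K) bK => -[/IH[s sL]].
have sa : s a \notin K :\ b by rewrite -sL mem_imset //; apply: perm_inj.
exists (s * tperm (s a) b)%g; rewrite imsetU1 permM tpermL -[RHS](setD1K bK) -sL.
congr (_ |: _); apply: eq_in_imset => x xL; rewrite permM tpermD //.
  by rewrite (inj_eq perm_inj); apply: contraNneq aL => ->.
by apply: contraTneq (imset_f s xL) => <-; rewrite sL !inE eqxx.
Qed.

Section EvaluationMatrix.

Variables (F : fieldType) (n : nat).
Hypothesis nz2 : 2%:R != 0 :> F.
Implicit Types (J K : {set 'I_n}) (s t : {perm 'I_n}) (a b : 'I_n) (P : pred nat).

Local Notation rho := (@rho F n).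
Local Notation wedge := (wedge F n).
Local Notation degp := (degp F n).

Definition all_even : {ffun 'I_n -> bool} := [ffun => false].

(* For a coefficient row f, the entry (f *m evalmx) J is, up to normalization, the
   value of f when the variables y_j, j \in J, are odd elements of a Grassmann
   algebra and all other variables are central. *)
Definition evalmx := fmx (fun (m : mono n) J =>
  (m.1 == all_even)%:R * eta F m.2^-1%g J).

Lemma actmxE (c : {ffun 'I_n -> bool}) s :
  actmx F c s =
  fmx (fun m m' : mono n => (m' == act_mono s m)%:R * act_sign F c s m).
Proof.
by apply/matrixP=> i j; rewrite !mxE; case: eqP => _; rewrite ?mul1r ?mul0r.
Qed.

Lemma act_mono_even s (m : mono n) :
  ((act_mono s m).1 == all_even) = (m.1 == all_even).
Proof.
apply/eqP/eqP=> [|m0]; last by apply/ffunP=> i; rewrite /= !ffunE m0 ffunE.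
move=> m0; apply/ffunP=> i; have /ffunP/(_ (s i)) := m0.
by rewrite !ffunE permK.
Qed.

(** Monomials with an odd variable have zero rows in [evalmx], and on the others the signs [c] act
    trivially. *)
Lemma actmx_evalmx c s : actmx F c s *m evalmx = evalmx *m rho s.
Proof.
rewrite actmxE !fmxM; apply: eq_fmx => m K.
under eq_bigr => m' _ do rewrite -mulrA.
rewrite sum_delta act_mono_even.
under [RHS]eq_bigr => J _ do rewrite imset_permV mulrCA.
rewrite sum_delta.
have [m0|_] := eqVneq m.1 all_even; last by rewrite !mul0r mulr0.
rewrite /act_sign big1 => [|i]; last by rewrite m0 ffunE.
rewrite !mul1r /= invMg etaM mulrC; congr (_ * _).
by rewrite -[LHS]etaV invgK.
Qed.

(** The row of [evalmx] at y_1 ... y_n, which lists every set in increasing order; by [row_evalmx]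
    the other monomials in even variables give its translates. *)
Definition omega : 'rV[F]_#|{set 'I_n}| := const_mx 1.

Lemma mul_row_rho (v : 'rV[F]_#|{set 'I_n}|) s K :
  (v *m rho s) 0 (enum_rank K) = v 0 (enum_rank (s^-1%g @: K)) * eta F s^-1%g K.
Proof.
rewrite mxE sum_enum_rank.
under eq_bigr => J _ do rewrite fmxE imset_permV mulrCA.
by rewrite sum_delta -[eta F s _]etaV -imset_permM mulVg imset_perm1.
Qed.

Lemma row_rankP (I : finType) (u v : 'rV[F]_#|I|) :
  (forall i, u 0 (enum_rank i) = v 0 (enum_rank i)) -> u = v.
Proof.
by move=> uv; apply/rowP=> i; have := uv (enum_val i); rewrite enum_valK.
Qed.

Lemma row_evalmx (m : mono n) :
  row (enum_rank m) evalmx = (m.1 == all_even)%:R *: (omega *m rho m.2).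
Proof.
apply: row_rankP => K; rewrite [LHS]mxE fmxE [RHS]mxE mul_row_rho.
by rewrite [omega _ _]mxE mul1r.
Qed.

(** The signs alternate along [K], starting with 1. Removing the maximum leaves the signs of the
    other elements unchanged. *)
Lemma sum_kappa K : \sum_(a in K) kappa F a (K :\ a) = (odd #|K|)%:R.
Proof.
have [m] := ubnP #|K|; elim: m K => // m IHm K ltKm.
have [->|[x xK]] := set_0Vmem K; first by rewrite big_set0 cards0.
have [z zK maxz] := @arg_maxnP _ x (mem K) val xK; have {}zK : z \in K by [].
have ltz b : b \in K -> b != z -> (b < z)%N.
  by move=> bK bz; rewrite ltn_neqAle (inj_eq val_inj) bz; apply: maxz.
have ltDm : (#|K :\ z| < m)%N by move: ltKm; rewrite (cardsD1 z) zK ltnS.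
rewrite (bigD1 z) //= [X in _ + X](eq_bigl (mem (K :\ z))); last first.
  by move=> b; rewrite !inE andbC.
rewrite [X in _ + X](eq_bigr (fun b => kappa F b (K :\ z :\ b))); last first.
  move=> b; rewrite !inE => /andP[bz bK].
  have -> : K :\ b = z |: (K :\ z :\ b).
    apply/setP=> y; rewrite !inE; case: (eqVneq y z) => [->|] //=.
    by rewrite eq_sym bz zK.
  by rewrite kappaU1 ?sgo_lt ?mul1r ?ltz // !inE eqxx andbF.
rewrite IHm // (cardsD1 z K) zK /kappa (eq_bigr (fun=> -1)); last first.
  move=> b; rewrite !inE => /andP[bz bK].
  by rewrite sgoC ?sgo_lt ?ltz // neq_ltn ltz ?orbT.
rewrite prodr_const -signr_odd oddD; case: (odd #|K :\ z|) => /=.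
  by rewrite expr1 addNr.
by rewrite expr0 addr0.
Qed.

Lemma omega_even_wedge : omega *m degp (predC odd) *m wedge = omega *m degp odd.
Proof.
rewrite -(eq_degp F n (P := odd \o succn)) // -mulmxA degp_wedge mulmxA.
apply: row_rankP => K; rewrite [LHS]mxE [RHS]mxE !sum_enum_rank.
under eq_bigr => J _ do rewrite fmxE eq_sym mulrCA.
rewrite sum_delta.
under [RHS]eq_bigr => J _ do rewrite fmxE eq_sym mulrCA.
rewrite sum_delta [omega 0 _]mxE mul1r.
case: (boolP (odd #|K|)) => [oddK|_]; last by rewrite mulr0.
rewrite mulr1 mxE sum_enum_rank.
under eq_bigr => J _ do rewrite mxE fmxE mul1r.
have := sum_kappa K; rewrite oddK => <-; rewrite exchange_big [RHS]big_mkcond /=.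
apply: eq_bigr => a _; case: ifPn => aK; last first.
  rewrite big1 // => J _; case: (eqVneq K (a |: J)) => [KE|]; last by rewrite mul0r mulr0.
  by rewrite KE setU11 in aK.
rewrite (bigD1 (K :\ a)) //= !inE eqxx /= mul1r setD1K // eqxx mul1r.
rewrite big1 ?addr0 // => J KJ; have [aJ|aJ] := boolP (a \in J); first by rewrite mul0r.
case: (eqVneq K (a |: J)) => [KE|]; last by rewrite mul0r mulr0.
by rewrite KE setU1K ?eqxx in KJ.
Qed.

(** For y_1 ... y_n this is [sum_kappa], and equivariance carries it to all monomials. Hence the
    values on odd sets are determined by those on even sets. *)
Lemma evalmx_even_wedge : evalmx *m degp (predC odd) *m wedge = evalmx *m degp odd.
Proof.
apply/row_matrixP=> i; rewrite -(enum_valK i) !row_mul row_evalmx.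
rewrite -!scalemxAl; congr (_ *: _).
rewrite -!(mulmxA omega) -!degp_rho -(mulmxA _ _ wedge) rho_wedge !mulmxA.
by rewrite omega_even_wedge.
Qed.

(** Such an exchange of neighbours preserves the order of the elements of [K]. *)
Lemma eta_tperm_succ a b K : b = a.+1 :> nat -> ~~ ((a \in K) && (b \in K)) ->
  eta F (tperm a b) K = 1.
Proof.
move=> ba abK; rewrite -[RHS](eta1 F K); apply: eq_pairprod => x y xK yK ltxy.
have tE z : tperm a b z = (if z == a :> nat then a.+1
    else if z == a.+1 :> nat then nat_of_ord a else z) :> nat.
  rewrite -ba !(inj_eq val_inj); case: tpermP => [->|->|/eqP/negbTE-> /eqP/negbTE->] //.
    by rewrite eqxx.
  by rewrite eqxx; case: eqP => [->|].
have notab : ~~ ((x == a :> nat) && (y == a.+1 :> nat)).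
  rewrite -ba !(inj_eq val_inj); apply: contra abK => /andP[/eqP<- /eqP<-].
  by rewrite xK yK.
rewrite !perm1 [RHS]sgo_lt // sgo_lt // !tE.
by case: eqP notab; case: eqP; do ?case: eqP; lia.
Qed.

Definition initset (m : nat) : {set 'I_n} := [set i : 'I_n | (i < m)%N].

Definition evenrow (m : nat) : 'rV[F]_#|{set 'I_n}| :=
  \row_j (fun K : {set 'I_n} => ((initset m \subset K) && ~~ odd #|K|)%:R)
    (enum_val j).

Lemma evenrowE m K :
  evenrow m 0 (enum_rank K) = ((initset m \subset K) && ~~ odd #|K|)%:R.
Proof. by rewrite mxE enum_rankK. Qed.

Lemma card_initset m : (m <= n)%N -> #|initset m| = m.
Proof.
move=> lemn; rewrite cardsE -sum1_card -(big_ord_widen n (fun=> 1%N)) //.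
by rewrite sum1_card card_ord.
Qed.

Lemma evalmx_even_stable s : stablemx (evalmx *m degp (predC odd)) (rho s).
Proof.
by rewrite -mulmxA degp_rho mulmxA -(actmx_evalmx all_even) -mulmxA submxMl.
Qed.

(* Subtracting the image under the transposition of two adjacent positions keeps
   only the odd sets that contain both of them. *)
Lemma evenrow_sub m : (2 * m <= n)%N ->
  (evenrow (2 * m) <= evalmx *m degp (predC odd))%MS.
Proof.
elim: m => [_|m IHm].
  (* The starting vector is the even part of [omega], which is the row of y_1 ... y_n. *)
  have -> : evenrow (2 * 0)
     = row (enum_rank ((all_even, 1%g) : mono n)) (evalmx *m degp (predC odd)).
    rewrite row_mul row_evalmx eqxx scale1r rho1 mulmx1; apply: row_rankP => K.
    rewrite evenrowE mxE sum_enum_rank.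
    under eq_bigr => J _ do rewrite mxE mul1r fmxE eq_sym.
    have -> : initset (2 * 0) = set0 by apply/setP=> i; rewrite !inE muln0.
    by rewrite sum_delta sub0set.
  exact: row_sub.
rewrite mulnS addSn add1n => ltmn.
have lt0 : (2 * m < n)%N by apply: ltnW.
have := IHm (ltnW lt0); set u := evenrow _ => uU.
pose a := Ordinal lt0; pose b := Ordinal ltmn.
(* On sets containing both [a] and [b] the transposition acts by [-1] and the difference doubles the
   coefficient; on all other sets the two terms cancel. *)
have -> : evenrow (2 * m).+2 = 2%:R^-1 *: (u - u *m rho (tperm a b)).
  apply: row_rankP => K; rewrite [RHS]mxE [X in _ * X]mxE [X in _ + X]mxE mul_row_rho tpermV.
  rewrite /u !evenrowE card_imset; last exact: perm_inj.
  have -> : (initset (2 * m) \subset tperm a b @: K) = (initset (2 * m) \subset K).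
    have fix_u x : x \in initset (2 * m) -> tperm a b x = x.
      by rewrite inE => xm; apply: tpermD; rewrite -(inj_eq val_inj) /=; lia.
    apply/subsetP/subsetP => sub x xm; have := sub x xm.
      by case/imsetP=> y yK xE; have := fix_u x xm; rewrite {1}xE tpermK => <-.
    by move=> xK; rewrite -(fix_u x xm); apply: imset_f.
  have -> : (initset (2 * m).+2 \subset K)
          = [&& initset (2 * m) \subset K, a \in K & b \in K].
    apply/subsetP/and3P => [sub|[/subsetP sub aK bK] x].
      split; [apply/subsetP=> x|apply: sub|apply: sub]; rewrite ?inE //=.
      by move=> xm; apply: sub; rewrite inE; lia.
    rewrite inE => xm; have [xa|xa] := eqVneq x a; first by rewrite xa.
    have [xb|xb] := eqVneq x b; first by rewrite xb.
    by apply: sub; rewrite inE; move: xa xb; rewrite -!(inj_eq val_inj) /=; lia.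
  case: (initset _ \subset K) => /=; last by rewrite mul0r subrr mulr0.
  case: (odd _) => /=; first by rewrite andbF mul0r subrr mulr0.
  rewrite mul1r andbT; case: (boolP ((a \in K) && (b \in K))) => [/andP[aK bK]|abK].
    by rewrite eta_tperm ?opprK -?mulr2n ?mulVf // -(inj_eq val_inj) /=; lia.
  by rewrite eta_tperm_succ // subrr mulr0.
apply: scalemx_sub; rewrite addmx_sub // eqmx_opp.
by apply: submx_trans (submxMr _ uU) (evalmx_even_stable _).
Qed.

(** Descending induction on the size of [J]: a translate of [evenrow] is supported on the even
    supersets of [J] with a nonzero entry at [J], and the strictly larger sets can be subtracted. *)
Lemma delta_sub_evalmx J : ~~ odd #|J| ->
  (delta_mx (0 : 'I_1) (enum_rank J) <= evalmx *m degp (predC odd))%MS.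
Proof.
have [d] := ubnP (n - #|J|); elim: d J => // d IHd J ltd evJ.
have Jn : (#|J| <= n)%N by rewrite -[n in (_ <= n)%N]card_ord max_card.
have Jm : (2 * #|J|./2 = #|J|)%N by rewrite mul2n even_halfK.
have [s sJ] : exists s : {perm 'I_n}, s @: initset #|J| = J.
  by apply: perm_imset_card; rewrite card_initset.
pose v := evenrow #|J| *m rho s.
have vU : (v <= evalmx *m degp (predC odd))%MS.
  apply: submx_trans (evalmx_even_stable s); apply: submxMr.
  by rewrite -Jm evenrow_sub // Jm.
have vE K : v 0 (enum_rank K) = ((J \subset K) && ~~ odd #|K|)%:R * eta F s^-1%g K.
  rewrite mul_row_rho evenrowE card_imset; last exact: perm_inj.
  congr ((_ && _)%:R * _); rewrite -{2}sJ; apply/subsetP/subsetP => sub x.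
    case/imsetP=> y yJ ->; have /imsetP[z zK ->] := sub y yJ.
    by rewrite -permM mulVg perm1.
  by move=> xJ; rewrite -[x](permK s); apply: imset_f; apply: sub; apply: imset_f.
have nzv : v 0 (enum_rank J) != 0.
  rewrite vE subxx evJ mul1r; apply: contraTneq isT => e0.
  by have := eta_sqr F s^-1%g J; rewrite e0 mul0r => /esym/eqP; rewrite oner_eq0.
have defe : delta_mx (0 : 'I_1) (enum_rank J) = (v 0 (enum_rank J))^-1 *:
    (v - \sum_(j | j != enum_rank J) v 0 j *: delta_mx 0 j).
  rewrite {2}[v]row_sum_delta (bigD1 (enum_rank J)) //= addrK scalerA mulVf //.
  by rewrite scale1r.
rewrite defe; apply: scalemx_sub; rewrite addmx_sub // eqmx_opp summx_sub // => j jJ.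
rewrite -(enum_valK j) in jJ *; move: jJ; rewrite (inj_eq enum_rank_inj).
set K := enum_val j => KJ; rewrite vE.
case: (boolP (_ && _)) => [/andP[JK evK]|_]; last by rewrite mul0r scale0r sub0mx.
apply: scalemx_sub; apply: IHd => //.
have : (#|J| < #|K|)%N by rewrite proper_card // properEneq eq_sym KJ.
have : (#|K| <= n)%N by rewrite -[n in (_ <= n)%N]card_ord max_card.
lia.
Qed.

Lemma evalmx_even_eqmx : (evalmx *m degp (predC odd) :=: degp (predC odd))%MS.
Proof.
apply/eqmxP; rewrite submxMl /=; apply/row_subP => i.
rewrite -(enum_valK i); set J := enum_val i.
have [evJ|oddJ] := boolP (~~ odd #|J|).
  rewrite (_ : row _ _ = delta_mx 0 (enum_rank J)) ?delta_sub_evalmx //.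
  apply: row_rankP => K; rewrite !mxE !enum_rankK eqxx /= evJ mulr1.
  by rewrite (inj_eq enum_rank_inj).
rewrite (_ : row _ _ = 0) ?sub0mx //.
by apply: row_rankP => K; rewrite !mxE !enum_rankK /= (negbTE oddJ) mulr0.
Qed.

End EvaluationMatrix.

(** * Products and evaluations in the Grassmann algebra *)

Section Grassmann.

Variables (F : fieldType) (m : nat).
Implicit Types (S T U : {set 'I_m}) (x y : grass F m).

(** The zero on the diagonal reflects e_a e_a = 0 and lets [gsign] factor over pairs with no
    disjointness case. *)
Definition sgo0 (a b : 'I_m) : F := if a == b then 0 else sgo F a b.

Lemma sgo0C a b : sgo0 a b = - sgo0 b a.
Proof.
by rewrite /sgo0 [b == a]eq_sym; case: eqVneq => [_|ab]; rewrite ?oppr0 // sgoC.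
Qed.

Lemma gsignE S T : gsign F S T = \prod_(a in S) \prod_(b in T) sgo0 a b.
Proof.
rewrite /gsign; case: ifPn => [disj|]; last first.
  rewrite -setI_eq0 => /set0Pn[x /setIP[xS xT]].
  by rewrite (bigD1 x) //= (bigD1 x xT) /= /sgo0 eqxx !mul0r.
rewrite pair_big_dep /= -prodr_const big_mkcond [RHS]big_mkcond; apply: eq_bigr => -[a b] _ /=.
rewrite !inE /=; case: (boolP ((a \in S) && (b \in T))) => [/andP[aS bT]|] /=; last first.
  by [].
rewrite /sgo0 /sgo; case: eqVneq => [ab|ab].
  by have := disjointFr disj aS; rewrite ab bT.
by move: ab; rewrite -(inj_eq val_inj) /=; case: ltngtP.
Qed.

Lemma gsignC S T : gsign F S T = (-1) ^+ (odd #|S| && odd #|T|) * gsign F T S.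
Proof.
rewrite !gsignE exchange_big /=.
transitivity (\prod_(b in T) \prod_(a in S) (-1 * sgo0 b a)).
  by apply: eq_bigr => b _; apply: eq_bigr => a _; rewrite mulN1r -sgo0C.
under eq_bigr => b _ do rewrite big_split prodr_const /=.
by rewrite big_split prodr_const /= -exprM -signr_odd oddM.
Qed.

Lemma gsign_disjoint S T : gsign F S T != 0 -> [disjoint S & T].
Proof. by rewrite /gsign; case: ifP => // _; rewrite eqxx. Qed.

Lemma gsign_neq0 S T : [disjoint S & T] -> gsign F S T != 0.
Proof. by rewrite /gsign => ->; rewrite signr_eq0. Qed.

Lemma gmulE x y U :
  gmul x y U = \sum_S \sum_T (S :|: T == U)%:R * (x S * y T * gsign F S T).
Proof.
rewrite ffunE; apply: eq_bigr => S _; apply: eq_bigr => T _.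
by case: eqP; rewrite ?mul1r ?mul0r.
Qed.

Section Products.

Variable n : nat.
Implicit Types (Ss : {ffun 'I_n -> {set 'I_m}}).

(** The coefficient of the basis element of the union in the product of the e_(Ss i), taken in
    increasing order of i; it vanishes when two of the sets meet. *)
Definition signs Ss := pairprod [set: 'I_n] (fun i j => gsign F (Ss i) (Ss j)).

Definition oddset Ss : {set 'I_n} := [set i | odd #|Ss i|].

Lemma pairprodT (G : 'I_n -> 'I_n -> F) :
  pairprod setT G = \prod_(i < n) \prod_(j < n | (i < j)%N) G i j.
Proof.
rewrite /pairprod; apply: eq_big => [i|i _]; first by rewrite inE.
by apply: eq_bigl => j; rewrite inE.
Qed.

Lemma signs_disjoint Ss i j : signs Ss != 0 -> i != j -> [disjoint Ss i & Ss j].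
Proof.
rewrite /signs pairprodT => /prodf_neq0 nz.
wlog ltij : i j / (i < j)%N => [H ij|_].
  have [lt|lt|eq] := ltngtP i j; first exact: H.
    by rewrite disjoint_sym H // eq_sym.
  by rewrite (val_inj eq) eqxx in ij.
by apply: gsign_disjoint; move/prodf_neq0: (nz i isT); apply.
Qed.

Lemma signs_neq0 Ss :
  (forall i j, i != j -> [disjoint Ss i & Ss j]) -> signs Ss != 0.
Proof.
move=> disj; rewrite /signs pairprodT; apply/prodf_neq0 => i _.
apply/prodf_neq0 => j ltij; apply/gsign_neq0/disj.
by rewrite -(inj_eq val_inj) neq_ltn ltij.
Qed.

Lemma gsign_bigcup S Ss : signs Ss != 0 ->
  gsign F S (\bigcup_i Ss i) = \prod_i gsign F S (Ss i).
Proof.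
move=> nz; rewrite gsignE exchange_big /= partition_disjoint_bigcup /=; last first.
  by move=> i j; apply: signs_disjoint.
by apply: eq_bigr => i _; rewrite gsignE exchange_big.
Qed.

Lemma pairprod_mkcond (J : {set 'I_n}) (G : 'I_n -> 'I_n -> F) :
  pairprod J G = pairprod setT (fun i j => if (i \in J) && (j \in J) then G i j else 1).
Proof.
rewrite pairprodT /pairprod [LHS]big_mkcond; apply: eq_bigr => i _ /=.
case: ifP => [iJ|iJ]; last by rewrite big1.
by rewrite big_mkcondl.
Qed.

(* Only transpositions of two odd factors produce a sign. *)
Lemma signs_perm Ss (t : {perm 'I_n}) :
  signs [ffun i => Ss (t i)] = eta F t^-1%g (oddset Ss) * signs Ss.
Proof.
set J := oddset Ss.
(* [h] compensates the sign from exchanging two odd factors, so [G] is symmetric and can be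
   relabelled along [t]; on increasing pairs [h] is 1. *)
pose h a b : F := if (a \in J) && (b \in J) then sgo F a b else 1.
pose G a b : F := if a == b then 1 else gsign F (Ss a) (Ss b) * h a b.
have symG a b : G a b = G b a.
  rewrite /G [b == a]eq_sym; case: eqVneq => // ab; rewrite gsignC /h !inE [RHS]mulrC.
  rewrite [odd #|Ss b| && _]andbC; case: (_ && _); last by rewrite mulr1 !mul1r.
  by rewrite [sgo F b a]sgoC 1?eq_sym // expr1 mulN1r !mulNr mulrC.
have GE : signs [ffun i => Ss (t i)] * pairprod setT (fun i j => h (t i) (t j))
        = signs Ss.
  rewrite /signs -pairprodM.
  transitivity (pairprod setT (fun i j => G (t i) (t j))).
    apply: eq_pairprod => i j _ _ ltij; rewrite !ffunE /G (inj_eq perm_inj).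
    by rewrite -(inj_eq val_inj) (ltn_eqF ltij).
  rewrite pairprod_perm // (_ : t @: setT = setT); last first.
    by apply/setP=> i; rewrite -(permKV t i) imset_f ?inE.
  apply: eq_pairprod => i j _ _ ltij; rewrite /G /h sgo_lt // if_same mulr1.
  by rewrite -(inj_eq val_inj) (ltn_eqF ltij).
have hE : pairprod setT (fun i j => h (t i) (t j)) = eta F t^-1%g J.
  rewrite -etaV invgK [RHS]pairprod_mkcond; apply: eq_pairprod => i j _ _ _.
  by rewrite -(mem_imset _ _ (@perm_inj _ t)) -(mem_imset _ j (@perm_inj _ t))
    -imset_permM mulVg imset_perm1.
by rewrite -GE hE mulrCA eta_sqr mulr1.
Qed.

End Products.

Definition fcons n (p : {set 'I_m} * {ffun 'I_n -> {set 'I_m}}) :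
    {ffun 'I_n.+1 -> {set 'I_m}} :=
  [ffun i => oapp p.2 p.1 (unlift ord0 i)].

Lemma fcons0 n p : @fcons n p ord0 = p.1.
Proof. by rewrite ffunE unlift_none. Qed.

Lemma fconsS n p i : @fcons n p (lift ord0 i) = p.2 i.
Proof. by rewrite ffunE liftK. Qed.

Lemma fcons_bij n : bijective (@fcons n).
Proof.
exists (fun f : {ffun 'I_n.+1 -> {set 'I_m}} =>
  (f ord0, [ffun i : 'I_n => f (lift ord0 i)])) => [[S f]|f].
  by rewrite fcons0 /=; congr pair; apply/ffunP=> i; rewrite ffunE fconsS.
apply/ffunP=> i; case: (unliftP ord0 i) => [j ->|->]; last by rewrite fcons0.
by rewrite fconsS ffunE.
Qed.

Lemma signs_fcons n p : signs (@fcons n p) =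
  (\prod_i gsign F p.1 (p.2 i)) * signs p.2.
Proof.
rewrite /signs !pairprodT big_ord_recl; congr (_ * _).
  rewrite big_mkcond big_ord_recl /= mul1r; apply: eq_bigr => i _.
  by rewrite fcons0 fconsS.
apply: eq_bigr => i _; rewrite big_mkcond big_ord_recl /= mul1r [RHS]big_mkcond.
by apply: eq_bigr => j _; rewrite !fconsS.
Qed.

Lemma gmul_bigE n (x : 'I_n -> grass F m) U :
  (\big[@gmul F m/@gone F m]_(i < n) x i) U =
  \sum_(Ss : {ffun 'I_n -> {set 'I_m}})
    (\bigcup_i Ss i == U)%:R * (\prod_i x i (Ss i) * signs Ss).
Proof.
elim: n x U => [|n IHn] x U.
  rewrite big_ord0 ffunE (big_pred1 [ffun=> set0]) => [|f]; last first.
    by apply/esym/eqP/ffunP => -[].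
  by rewrite !big_ord0 /signs pairprodT big_ord0 !mulr1 eq_sym.
rewrite big_ord_recl gmulE (reindex (@fcons n)); last exact/onW_bij/fcons_bij.
rewrite -(pair_bigA _ (fun S f => (\bigcup_i fcons (S, f) i == U)%:R *
   (\prod_i x i (fcons (S, f) i) * signs (fcons (S, f))))) /=.
apply: eq_bigr => S _.
under eq_bigr => T _ do rewrite IHn mulr_sumr mulr_suml mulr_sumr.
rewrite exchange_big; apply: eq_bigr => f _ /=.
rewrite (eq_bigr (fun T => (T == \bigcup_i f i)%:R * ((S :|: T == U)%:R *
   (x ord0 S * (\prod_i x (lift ord0 i) (f i) * signs f) * gsign F S T)))); last first.
  by move=> T _; rewrite [_ == T]eq_sym; ring.
rewrite sum_delta !big_ord_recl fcons0 signs_fcons /=.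
have -> : \bigcup_i fcons (S, f) (lift ord0 i) = \bigcup_i f i.
  by apply: eq_bigr => i _; rewrite fconsS.
have -> : \prod_i x (lift ord0 i) (fcons (S, f) (lift ord0 i))
        = \prod_i x (lift ord0 i) (f i).
  by apply: eq_bigr => i _; rewrite fconsS.
(* [gsign_bigcup] needs disjoint sets; when they meet, both sides are zero. *)
have [->|nz] := eqVneq (signs f) 0; first by rewrite !mulr0 !mul0r !mulr0.
by rewrite gsign_bigcup //; congr (_ * _); ring.
Qed.

Section Evaluation.

Variables (n : nat) (f : 'rV[F]_(PN n)) (a b : 'I_n -> grass F m).
Hypothesis b0 : forall i, b i = 0.

Lemma mono_valE (mo : mono n) U :
  mono_val (@gmul F m) (@gone F m) a b mo U =
  \sum_(Ss : {ffun 'I_n -> {set 'I_m}})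
    (mo.1 == all_even n)%:R * eta F mo.2^-1%g (oddset Ss) *
    ((\bigcup_i Ss i == U)%:R * (\prod_i a i (Ss i) * signs Ss)).
Proof.
case: mo => c t /=; rewrite /mono_val gmul_bigE /=.
(* Any odd variable is sent to 0, which kills the monomial. *)
have [->|nz] := eqVneq c (all_even n); last first.
  have [i ci] : exists i, c i.
    apply/existsP; apply: contraNT nz => /existsPn c0.
    by apply/eqP/ffunP=> i; rewrite ffunE; apply: negbTE.
  rewrite [RHS]big1 => [|Ss _]; last by rewrite !mul0r.
  rewrite big1 // => Ss _; rewrite [\prod_i _](bigD1 (t^-1%g i)) //= permKV ci b0 ffunE.
  by rewrite !mul0r mulr0.
(* After reindexing, [Ss i] belongs to the variable of index i instead of the position i, at the
   cost of the sign in [signs_perm]. *)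
rewrite (reindex (fun Ss : {ffun 'I_n -> {set 'I_m}} => [ffun i => Ss (t i)])); last first.
  exists (fun Ss : {ffun 'I_n -> {set 'I_m}} => [ffun i => Ss (t^-1%g i)]) => Ss _;
    by apply/ffunP=> i; rewrite !ffunE ?permK ?permKV.
apply: eq_bigr => Ss _; rewrite signs_perm mul1r.
rewrite (eq_bigr (fun i => Ss (t i))); last by move=> i _; rewrite ffunE.
rewrite -(reindex_inj (@perm_inj _ t) (P := xpredT) (F := Ss)) /=.
rewrite (eq_bigr (fun i => a (t i) (Ss (t i)))); last by move=> i _; rewrite !ffunE.
by rewrite -(reindex_inj (@perm_inj _ t) (P := xpredT) (F := fun i => a i (Ss i))) /=; ring.
Qed.

(** The reordering sign depends only on which variables receive basis elements of odd degree, so [f]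
    enters only through [f *m evalmx F n]. *)
Lemma poly_evalE U :
  poly_eval (@gmul F m) (@gone F m) f a b U =
  \sum_(Ss : {ffun 'I_n -> {set 'I_m}})
    (f *m evalmx F n) 0 (enum_rank (oddset Ss)) *
    ((\bigcup_i Ss i == U)%:R * (\prod_i a i (Ss i) * signs Ss)).
Proof.
have scaleE c (g : grass F m) : (c *: g) U = c * g U by rewrite ffunE.
rewrite /poly_eval sum_ffunE.
under eq_bigr => mo _ do rewrite scaleE mono_valE mulr_sumr.
rewrite exchange_big; apply: eq_bigr => Ss _ /=.
rewrite mxE sum_enum_rank mulr_suml; apply: eq_bigr => mo _.
by rewrite fmxE mulrA.
Qed.

End Evaluation.

End Grassmann.

(** * Identities and central polynomials in terms of the signed sums *)

Section GrassmannIdentities.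

Variables (F : fieldType) (m n : nat).
Hypothesis nz2 : 2%:R != 0 :> F.
Hypothesis even_m : ~~ odd m.
Implicit Types S T U : {set 'I_m}.

(** Even components commute with everything. For odd [U], evenness of [m] leaves a generator outside
    [U], with which e_U anticommutes to a nonzero product. *)
Lemma in_center_gmulP (x : grass F m) :
  in_center (@gmul F m) x <-> forall U : {set 'I_m}, odd #|U| -> x U = 0.
Proof.
split=> [cx U oddU|x_even y]; last first.
  apply/ffunP=> U; rewrite !gmulE [RHS]exchange_big; apply: eq_bigr => S _ /=.
  apply: eq_bigr => T _; rewrite setUC; congr (_ * _).
  have [oddS|evS] := boolP (odd #|S|); first by rewrite x_even // !(mul0r, mulr0).
  by rewrite gsignC (negbTE evS) mul1r [x S * _]mulrC.
have [z zU] : exists z, z \notin U.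
  apply/existsP; apply: contraNT even_m => /existsPn allU.
  rewrite -[m]card_ord -cardsT (_ : [set: 'I_m] = U) //.
  by apply/esym/setP=> z; rewrite inE; have := allU z; rewrite negbK.
have genE T : (@gen F m z) T = (T == [set z])%:R by rewrite ffunE.
have genr : gmul x (gen F z) (z |: U) = x U * gsign F U [set z].
  rewrite gmulE (bigD1 U) //= [X in _ + X]big1 => [|S SU].
    rewrite (eq_bigr (fun T => (T == [set z])%:R * ((U :|: T == z |: U)%:R
        * (x U * gsign F U T)))) => [|T _]; last by rewrite genE; ring.
    by rewrite sum_delta setUC eqxx mul1r addr0.
  rewrite (eq_bigr (fun T => (T == [set z])%:R * ((S :|: T == z |: U)%:R
        * (x S * gsign F S T)))) => [|T _]; last by rewrite genE; ring.
  rewrite sum_delta; case: eqP => [SzU|]; last by rewrite mul0r.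
  have [->|/gsign_disjoint] := eqVneq (gsign F S [set z]) 0; first by rewrite !mulr0.
  rewrite disjoint_sym disjoints1 => zS.
  by rewrite -(setU1K zS) setUC SzU setU1K ?eqxx in SU.
have genl : gmul (gen F z) x (z |: U) = x U * gsign F [set z] U.
  rewrite gmulE exchange_big (bigD1 U) //= [X in _ + X]big1 => [|S SU].
    rewrite (eq_bigr (fun T => (T == [set z])%:R * ((T :|: U == z |: U)%:R
        * (x U * gsign F T U)))) => [|T _]; last by rewrite genE; ring.
    by rewrite sum_delta eqxx mul1r addr0.
  rewrite (eq_bigr (fun T => (T == [set z])%:R * ((T :|: S == z |: U)%:R
        * (x S * gsign F T S)))) => [|T _]; last by rewrite genE; ring.
  rewrite sum_delta; case: eqP => [SzU|]; last by rewrite mul0r.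
  have [->|/gsign_disjoint] := eqVneq (gsign F [set z] S) 0; first by rewrite !mulr0.
  rewrite disjoints1 => zS.
  by rewrite -(setU1K zS) SzU setU1K ?eqxx in SU.
have := genl; rewrite -cx genr gsignC oddU cards1 expr1 mulN1r mulrN => /eqP.
rewrite eqr_oppLR -subr_eq0 opprK -mulr2n -mulr_natl !mulf_eq0 (negbTE nz2) /=.
rewrite (negbTE (gsign_neq0 _ _)) ?orbF; first by move/eqP.
by rewrite disjoints1.
Qed.

(** Disjointness makes the sizes add up. This supplies both the bound on the number of odd variables
    and the parity of the degree of a value. *)
Lemma card_bigcup_signs (Ss : {ffun 'I_n -> {set 'I_m}}) : signs F Ss != 0 ->
  exists h, #|\bigcup_i Ss i| = (#|oddset Ss| + 2 * h)%N.
Proof.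
move=> nz; exists (\sum_i #|Ss i|./2)%N.
rewrite -sum1_card partition_disjoint_bigcup /=; last first.
  by move=> i j; apply: signs_disjoint nz.
have -> : #|oddset Ss| = (\sum_i odd #|Ss i|)%N.
  by rewrite -sum1_card big_mkcond; apply: eq_bigr => i _; rewrite inE; case: (odd _).
rewrite big_distrr -big_split; apply: eq_bigr => i _.
by rewrite sum1_card /= mul2n odd_double_half.
Qed.

Lemma generic_evaluation (J : {set 'I_n}) : (#|J| <= m)%N ->
  exists (Ss : {ffun 'I_n -> {set 'I_m}}) (a : 'I_n -> grass F m),
  [/\ oddset Ss = J, signs F Ss != 0 &
    forall f : 'rV[F]_(PN n),
    poly_eval (@gmul F m) (@gone F m) f a (fun=> 0) (\bigcup_i Ss i)
    = (f *m evalmx F n) 0 (enum_rank J) * signs F Ss].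
Proof.
move=> leJm.
(* Distinct variables of [J] receive distinct generators, numbered by their position in [enum J];
   the others receive the unit. Then [Ss] is the only surviving term of [poly_evalE]. *)
pose Ss := [ffun i : 'I_n => if i \in J
  then [set z : 'I_m | z == index i (enum J) :> nat] else set0].
have ltJ i : i \in J -> (index i (enum J) < m)%N.
  by move=> iJ; apply: leq_trans leJm; rewrite cardE index_mem mem_enum.
have oddJ : oddset Ss = J.
  apply/setP=> i; rewrite inE ffunE; case: ifP => [iJ|_]; last by rewrite cards0.
  rewrite (_ : finset _ = [set Ordinal (ltJ i iJ)]) ?cards1 //.
  by apply/setP=> z; rewrite !inE -(inj_eq val_inj).
have nzS : signs F Ss != 0.
  apply: signs_neq0 => i j ij; rewrite -setI_eq0; apply/eqP/setP=> z.
  rewrite !ffunE; case: (boolP (i \in J)) => iJ; last by rewrite !inE.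
  case: (boolP (j \in J)) => jJ; last by rewrite !inE andbF.
  rewrite !inE; apply/negbTE/negP => /andP[/eqP-> /eqP eij]; case/eqP: ij.
  by rewrite -[i](nth_index i (s := enum J)) ?mem_enum // eij nth_index ?mem_enum.
pose a i : grass F m := [ffun S => (S == Ss i)%:R].
exists Ss, a; split=> // f; rewrite poly_evalE // (bigD1 Ss) //= oddJ eqxx mul1r.
rewrite [\prod_i _]big1 ?mul1r => [|i _]; last by rewrite ffunE eqxx.
rewrite big1 ?addr0 // => T TS.
have [i Ti] : exists i, T i != Ss i.
  apply/existsP; apply: contraNT TS => /existsPn eqT.
  by apply/eqP/ffunP=> i; apply/eqP; have := eqT i; rewrite negbK.
by rewrite [\prod_i _](bigD1 i) //= ffunE (negbTE Ti) !(mul0r, mulr0).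
Qed.

Lemma ident_grP (f : 'rV[F]_(PN n)) :
  ident_gr (@gmul F m) (@gone F m) (@triv0 F m) (@triv1 F m) f <->
  forall J : {set 'I_n}, (#|J| <= m)%N -> (f *m evalmx F n) 0 (enum_rank J) = 0.
Proof.
split=> [idf J /generic_evaluation[Ss [a [_ nz evE]]] | fJ a b _ b0].
  have := evE f; rewrite idf //; last by move=> i; rewrite inE.
  rewrite ffunE => /esym/eqP; rewrite mulf_eq0 (negbTE nz) orbF.
  by move/eqP.
apply/ffunP=> U; rewrite poly_evalE; last by move=> i; apply/eqP/b0.
rewrite ffunE big1 // => Ss _.
have [->|nz] := eqVneq (signs F Ss) 0; first by rewrite !mulr0.
rewrite fJ ?mul0r //; have [h cardU] := card_bigcup_signs nz.
apply: leq_trans (leq_addr (2 * h) _) _.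
by rewrite -cardU -[m in (_ <= m)%N]card_ord max_card.
Qed.

(** Each term has degree of the same parity as its [oddset], so odd [J] govern exactly the odd
    components, which must vanish in the center. *)
Lemma central_grP (f : 'rV[F]_(PN n)) :
  central_gr (@gmul F m) (@gone F m) (@triv0 F m) (@triv1 F m) f <->
  forall J : {set 'I_n}, odd #|J| -> (#|J| <= m)%N ->
    (f *m evalmx F n) 0 (enum_rank J) = 0.
Proof.
split=> [cf J oddJ /generic_evaluation[Ss [a [JE nz evE]]] | fJ a b _ b0].
  have /in_center_gmulP cev : in_center (@gmul F m)
    (poly_eval (@gmul F m) (@gone F m) f a (fun=> 0)).
    by apply: cf => // i; rewrite inE.
  have [h cardU] := card_bigcup_signs nz.
  have := evE f; rewrite cev; last by rewrite cardU JE mul2n oddD odd_double addbF.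
  by move/esym/eqP; rewrite mulf_eq0 (negbTE nz) orbF => /eqP.
apply/in_center_gmulP => U oddU; rewrite poly_evalE; last by move=> i; apply/eqP/b0.
rewrite big1 // => Ss _.
have [->|nz] := eqVneq (signs F Ss) 0; first by rewrite !mulr0.
have [h cardU] := card_bigcup_signs nz.
case: (eqVneq (\bigcup_i Ss i) U) => [UE|]; last by rewrite !(mul0r, mulr0).
rewrite fJ ?mul0r //; first by rewrite -UE cardU mul2n oddD odd_double addbF in oddU.
apply: leq_trans (leq_addr (2 * h) _) _.
by rewrite -cardU -[m in (_ <= m)%N]card_ord max_card.
Qed.

End GrassmannIdentities.

(** * Specht modules of hooks *)

Section HookSpecht.

Variables (F : fieldType) (n j : nat).
Hypothesis nz2 : 2%:R != 0 :> F.
Hypothesis lejn : (j <= n)%N.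
Implicit Types (J K : {set 'I_n.+1}) (s t g h p q u : {perm 'I_n.+1}).

Local Notation r := (n.+1 - j)%N.
Local Notation l := (hook r j).

Definition leg : {set 'I_n.+1} := [set i : 'I_n.+1 | (r <= i)%N].
Definition first_col : {set 'I_n.+1} := ord0 |: leg.

Lemma cell_of_nseq1 i x : (x < i)%N -> cell_of (nseq i 1%N) x = (x, 0%N).
Proof.
elim: i x => // i IHi [|x] //=; rewrite ltnS => ltxi.
by rewrite subn1 IHi.
Qed.

Lemma cell_of_hook (i : 'I_n.+1) :
  cell_of l i = if (i < r)%N then (0%N, i : nat) else ((i - r).+1, 0%N).
Proof.
rewrite /=; case: ifPn => // ri; rewrite cell_of_nseq1 //.
by have := ltn_ord i; lia.
Qed.

Lemma in_first_col i : (i \in first_col) = (i == ord0) || (i \in leg).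
Proof. exact: in_setU1. Qed.

Lemma ord0_leg : ord0 \notin leg.
Proof. by rewrite inE -ltnNge subn_gt0 ltnS. Qed.

Lemma row_grp_hookP p :
  reflect {in leg, forall i, p i = i} (p \in row_grp n.+1 l).
Proof.
have cE (i : 'I_n.+1) : (cell_of l i).1 = if (i < r)%N then 0%N else (i - r).+1.
  by rewrite cell_of_hook; case: ifP.
rewrite inE; apply: (iffP forallP) => [pR i | pL i].
  rewrite inE leqNgt => ri; have := pR i; rewrite !cE (negbTE ri).
  case: ifP => // rpi /eqP[e]; apply: val_inj => /=; move: ri rpi e; lia.
have [ri|ri] := ltnP i r; last by rewrite pL ?inE.
rewrite !cE ri; case: ifPn => //; rewrite -leqNgt => rpi.
have : p (p i) = p i by apply: pL; rewrite inE.
by move/perm_inj => pi; rewrite pi leqNgt ri in rpi.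
Qed.

Lemma col_grp_hookP q :
  reflect {in ~: first_col, forall i, q i = i} (q \in col_grp n.+1 l).
Proof.
have cE (i : 'I_n.+1) : (cell_of l i).2 = if i \in first_col then 0%N else i.
  rewrite cell_of_hook !inE [(r <= i)%N]leqNgt; case: ifP => _ /=; last by rewrite orbT.
  by rewrite orbF; case: eqP => [->|].
rewrite inE; apply: (iffP forallP) => [qC i | qB i].
  rewrite inE => iB; have := qC i; rewrite !cE (negbTE iB).
  case: ifP => _ /eqP e; last exact: val_inj.
  by case/negP: iB; rewrite !inE -(inj_eq val_inj) /= -e.
rewrite !cE; have [iB|iB] := boolP (i \in first_col); last first.
  by rewrite (qB i) ?(negbTE iB) ?eqxx // in_setC.
case: ifPn => // qiB; have : q (q i) = q i by apply: qB; rewrite inE.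
by move/perm_inj => qi; rewrite qi iB in qiB.
Qed.

Lemma col_grp_perm_on q : q \in col_grp n.+1 l -> perm_on first_col q.
Proof.
move=> /col_grp_hookP qB; apply/subsetP=> i; rewrite inE.
by apply: contraNT => iB; rewrite qB // inE.
Qed.

(** Row and column groups meet trivially. Concretely, [p] and [p'] agree away from the point that
    [p'] sends to [ord0], hence everywhere. *)
Lemma row_col_grp_inj p q p' q' :
  p \in row_grp n.+1 l -> q \in col_grp n.+1 l ->
  p' \in row_grp n.+1 l -> q' \in col_grp n.+1 l ->
  (p * q = p' * q')%g -> p = p' /\ q = q'.
Proof.
move=> /row_grp_hookP pL /col_grp_hookP qB /row_grp_hookP pL' /col_grp_hookP qB' e.
have fixp i : i != p'^-1%g ord0 -> p i = p' i.
  move=> ip; have [iL|iL] := boolP (i \in leg); first by rewrite pL ?pL'.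
  have piL s : {in leg, forall i, s i = i} -> s i \notin leg.
    move=> sL; apply: contra iL => siL.
    by have /perm_inj si := sL _ siL; rewrite si in siL.
  have p'iB : p' i \in ~: first_col.
    by rewrite in_setC in_first_col negb_or -(inj_eq (@perm_inj _ p'^-1%g)) permK ip piL.
  have [piB|] := boolP (p i \in ~: first_col).
    by have := congr1 (fun s => s i) e; rewrite /= !permM qB // qB'.
  rewrite in_setC negbK in_first_col (negbTE (piL _ pL)) orbF => /eqP pi0.
  have := congr1 (fun s => s i) e; rewrite /= !permM (qB' _ p'iB) => qi.
  have : q (p' i) = p' i by apply: qB.
  by rewrite -qi => /perm_inj; rewrite qi.
have eqpp : p = p'.
  apply/permP=> i; have [iE|] := eqVneq i (p'^-1%g ord0); last exact: fixp.
  rewrite iE permKV; apply/eqP; rewrite -[_ == _]negbK; apply/negP => pn0.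
  pose i' := p'^-1%g (p i).
  have : i' != p'^-1%g ord0 by rewrite (inj_eq perm_inj) iE.
  move=> ni'; have := fixp _ ni'; rewrite permKV => /perm_inj i'i.
  by rewrite i'i iE eqxx in ni'.
by split=> //; move: e; rewrite eqpp => /mulgI.
Qed.

Lemma row_grp_leg p (a : 'I_n.+1) : p \in row_grp n.+1 l ->
  p @: (a |: leg) = p a |: leg.
Proof.
move/row_grp_hookP=> pL; rewrite imsetU1; congr (_ |: _).
by rewrite -[RHS]imset_id; apply: eq_in_imset.
Qed.

Lemma kappa_leg a : a \notin leg -> kappa F a leg = 1.
Proof.
rewrite inE -ltnNge => ar; rewrite /kappa big1 // => b; rewrite inE => rb.
by rewrite sgo_lt // (leq_trans ar).
Qed.

Lemma hook_factor u (a : 'I_n.+1) : a \notin leg -> first_col = u @: (a |: leg) ->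
  exists p q, [/\ p \in row_grp n.+1 l, q \in col_grp n.+1 l & (p * q = u)%g].
Proof.
move=> aL uaL.
(* The row factor: it fixes the leg, sends [a] to the corner, and agrees with [u] elsewhere, so the
   remaining factor moves only the first column. *)
pose f (x : 'I_n.+1) := if x \in leg then x else if x == a then ord0 else u x.
have uB x : x \notin leg -> x != a -> u x \notin first_col.
  move=> xL xa; rewrite uaL mem_imset; last exact: perm_inj.
  by rewrite in_setU1 negb_or xa.
have f_inj : injective f.
  have sub x : x \in leg -> x \in first_col by move=> xL; rewrite in_first_col xL orbT.
  have B0 : ord0 \in first_col by rewrite in_first_col eqxx.
  have nL0 x : x \in leg -> x != ord0 by apply: contraTneq => ->; apply: ord0_leg.
  move=> x y; rewrite /f; case: (boolP (x \in leg)) => xL; case: (boolP (y \in leg)) => yL.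
  - by [].
  - case: eqVneq => [_ x0|ya xy]; first by have := nL0 x xL; rewrite x0 eqxx.
    by have := uB y yL ya; rewrite -xy sub.
  - case: eqVneq => [_ x0|ya xy]; first by have := nL0 y yL; rewrite -x0 eqxx.
    by have := uB x xL ya; rewrite xy sub.
  - case: (eqVneq x a) => [->|xa]; case: (eqVneq y a) => [->|ya] //.
    + by move=> e; have := uB y yL ya; rewrite -e B0.
    + by move=> e; have := uB x xL xa; rewrite e B0.
    + exact: perm_inj.
exists (perm f_inj), ((perm f_inj)^-1 * u)%g; split; last by rewrite mulKVg.
  by apply/row_grp_hookP => i iL; rewrite permE /f iL.
apply/col_grp_hookP => i; rewrite inE permM => iB.
have uiP : u^-1%g i \notin a |: leg.
  by rewrite -(mem_imset _ _ (@perm_inj _ u)) -uaL permKV.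
have -> : (perm f_inj)^-1%g i = u^-1%g i; last by rewrite permKV.
apply: (@perm_inj _ (perm f_inj)); rewrite permKV permE /f.
move: uiP; rewrite in_setU1 negb_or => /andP[/negbTE-> /negbTE->].
by rewrite permKV.
Qed.

(** Each side has at most one nonzero term: [u] factors as [(p * q)%g] in at most one way, and then
    [a] is the preimage of the corner under [p]. The factor [q] permutes the first column, where
    [eta] is its signature. *)
Lemma young_hookE u :
  \sum_(p in row_grp n.+1 l) \sum_(q in col_grp n.+1 l)
    (if (p * q)%g == u then (-1) ^+ odd_perm q else 0)
  = \sum_(a | a \notin leg) (first_col == u @: (a |: leg))%:R * eta F u (a |: leg).
Proof.
have [ex|nex] := boolP [exists pq : {perm 'I_n.+1} * {perm 'I_n.+1},
    [&& pq.1 \in row_grp n.+1 l, pq.2 \in col_grp n.+1 l & (pq.1 * pq.2)%g == u]].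
  case/existsP: ex => -[p q] /and3P[/= pR qC /eqP pqu].
  have qB := col_grp_perm_on qC.
  have pL := row_grp_hookP _ pR.
  rewrite (bigD1 p) //= (bigD1 q) //= pqu eqxx big1 => [|q' /andP[q'C q'q]]; last first.
    case: eqP => // e; have [_ e'] := row_col_grp_inj pR q'C pR qC (etrans e (esym pqu)).
    by rewrite e' eqxx in q'q.
  rewrite [X in _ + X]big1 => [|p' /andP[p'R p'p]]; last first.
    rewrite big1 // => q' q'C; case: eqP => // e.
    have [e' _] := row_col_grp_inj p'R q'C pR qC (etrans e (esym pqu)).
    by rewrite e' eqxx in p'p.
  rewrite !addr0.
  have uaE (a : 'I_n.+1) : (first_col == u @: (a |: leg)) = (p a |: leg == first_col).
    rewrite -pqu imset_permM row_grp_leg // -[in LHS](im_perm_on qB) eq_sym.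
    by rewrite (inj_eq (imset_inj (@perm_inj _ q))).
  pose a := p^-1%g ord0.
  have aL : a \notin leg.
    apply: contra ord0_leg => aL; rewrite -[ord0](permKV p) -/a.
    by rewrite (pL a aL).
  have pa : p a = ord0 by apply: permKV.
  rewrite (bigD1 a) //= uaE pa eqxx mul1r big1 => [|b /andP[bL ba]]; last first.
    rewrite uaE; case: eqP => [e|]; last by rewrite mul0r.
    have : ord0 \in p b |: leg by rewrite e in_first_col eqxx.
    rewrite in_setU1 (negbTE ord0_leg) orbF => /eqP pb.
    by case/eqP: ba; apply: (@perm_inj _ p); rewrite pa.
  rewrite addr0 -pqu etaM row_grp_leg // pa (eta_perm_on _ qB).
  (* [a] precedes the leg, and [p] sends it to [ord0] while fixing the leg, so the order is
     preserved. *)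
  rewrite (_ : eta F p (a |: leg) = 1) ?mul1r //.
  have aleg b : b \in leg -> (a < b)%N.
    rewrite !inE => rb; apply: leq_trans rb; move: aL; rewrite inE.
    by rewrite ltnNge.
  rewrite etaU1 // eta_id // mul1r big1 // => b bL.
  rewrite pa pL // !sgo_lt ?mulr1 ?aleg // lt0n; apply: contraNneq ord0_leg => b0.
  by rewrite (_ : ord0 = b) //; apply: val_inj.
rewrite big1 => [|p pR]; last first.
  rewrite big1 // => q qC; case: eqP => // pqu; case/existsP: nex.
  by exists (p, q); rewrite /= pR qC pqu eqxx.
rewrite big1 // => a aL; case: eqP => [e|]; last by rewrite mul0r.
have [p [q [pR qC pqu]]] := hook_factor aL e.
by case/existsP: nex; exists (p, q); rewrite /= pR qC pqu eqxx.
Qed.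

Definition rho_entry s J K : F := (K == s @: J)%:R * eta F s J.

Lemma rho_entryM s t J K :
  \sum_J' rho_entry s J J' * rho_entry t J' K = rho_entry (s * t)%g J K.
Proof.
have /matrixP/(_ (enum_rank J) (enum_rank K)) := rhoM F s t.
by rewrite fmxM !fmxE.
Qed.

(** The row of [g] is the translate of e_leg by the inverse of [g]; the column of [h] in [col_orbit]
    reads off the e_first_col coordinate after acting by [h]. *)
Definition leg_orbit := fmx (fun g J => rho_entry g^-1%g leg J).
Definition col_orbit := fmx (fun J h => rho_entry h J first_col).

(* Up to the choice of coordinates, right multiplication by the Young symmetrizer of
   a hook is the exterior product with \sum_a e_a. *)
Lemma specht_mx_hook :
  specht_mx F n.+1 l = leg_orbit *m wedge F n.+1 *m col_orbit.
Proof.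
apply: (@matrix_rankP _ {perm 'I_n.+1} {perm 'I_n.+1}) => g h.
rewrite [LHS]mxE enum_rankK mxE enum_rankK !fmxM fmxE.
transitivity (\sum_(p in row_grp n.+1 l) \sum_(q in col_grp n.+1 l)
    (if (p * q)%g == (g^-1 * h)%g then (-1) ^+ odd_perm q else 0 : F)).
  apply: eq_bigr => p _; apply: eq_bigr => q _.
  by rewrite -[(p * q)%g == (g^-1 * h)%g](inj_eq (mulgI g)) mulKVg.
rewrite young_hookE.
have /matrixP/(_ (enum_rank leg) (enum_rank first_col)) :
  rho F g^-1%g *m wedge F n.+1 *m rho F h = wedge F n.+1 *m rho F (g^-1 * h)%g.
  by rewrite rho_wedge rhoM mulmxA.
rewrite !fmxM !fmxE => ->; rewrite /wedge_coef.
under [RHS]eq_bigr => J _ do rewrite mulr_suml.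
rewrite exchange_big [LHS]big_mkcond; apply: eq_bigr => a _ /=.
case: ifPn => aL; last by rewrite big1 // => J _; rewrite !mul0r.
under [RHS]eq_bigr => J _ do rewrite mul1r -mulrA.
by rewrite sum_delta kappa_leg // mul1r.
Qed.

Lemma card_leg : #|leg| = j.
Proof.
have -> : leg = [set rev_ord i | i in [set i : 'I_n.+1 | (i < j)%N]].
  apply/setP=> i; rewrite inE; apply/idP/imsetP => [ri|[k + ->]].
    exists (rev_ord i); last by rewrite rev_ordK.
    by rewrite inE /=; have := ltn_ord i; move: ri lejn; lia.
  by rewrite inE /=; have := ltn_ord k; move: lejn; lia.
by rewrite card_imset; [rewrite card_initset // ltnW | apply: rev_ord_inj].
Qed.

Lemma card_first_col : #|first_col| = j.+1.
Proof. by rewrite cardsU1 ord0_leg card_leg. Qed.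

Lemma rho_entry2 s J K : rho_entry s J K * eta F s J = (K == s @: J)%:R.
Proof. by rewrite /rho_entry -mulrA eta_sqr mulr1. Qed.

(** Permutations act transitively on subsets of size [j], so the translates of e_leg span
    Lambda^j. *)
Lemma leg_orbit_eqmx : (leg_orbit :=: degp F n.+1 (pred1 j))%MS.
Proof.
apply/eqmxP/andP; split.
  rewrite (_ : leg_orbit = leg_orbit *m degp F n.+1 (pred1 j)) ?submxMl //.
  rewrite mul_degpr; apply: eq_fmx => g J; rewrite /rho_entry.
  case: eqP => [->|]; last by rewrite !mul0r.
  by rewrite card_imset ?card_leg /= ?eqxx ?mulr1 //; apply: perm_inj.
(* The default [1%g] occurs only for sets of another size, where the coefficient is 0. *)
pose t J : {perm 'I_n.+1} := odflt 1%g [pick s : {perm 'I_n.+1} | s^-1%g @: leg == J].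
suff -> : degp F n.+1 (pred1 j) =
    fmx (fun J g => (g == t J)%:R * ((#|J| == j)%:R * eta F g^-1%g leg)) *m leg_orbit.
  exact: submxMl.
rewrite fmxM; apply: eq_fmx => J K.
under [RHS]eq_bigr => g _ do rewrite -mulrA.
rewrite sum_delta -mulrA [_ * rho_entry _ _ _]mulrC rho_entry2 [RHS]mulrC /=.
have [cardJ|] := eqVneq #|J| j; last by rewrite !mulr0.
rewrite !mulr1 (_ : (t J)^-1%g @: leg = J) // /t.
case: pickP => [s /eqP //|none] /=.
have [s sL] := perm_imset_card (etrans card_leg (esym cardJ)).
by have := none s^-1%g; rewrite invgK sL eqxx.
Qed.

Lemma col_orbit_inj :
  exists coK, degp F n.+1 (pred1 j.+1) *m col_orbit *m coK = degp F n.+1 (pred1 j.+1).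
Proof.
pose t J : {perm 'I_n.+1} := odflt 1%g [pick s : {perm 'I_n.+1} | s @: J == first_col].
exists (fmx (fun h J => (h == t J)%:R * ((#|J| == j.+1)%:R * eta F h J))).
rewrite mul_degp fmxM; apply: eq_fmx => J K.
under eq_bigr => h _ do rewrite mulrCA.
rewrite sum_delta /=; have [cardK|cardK] := eqVneq #|K| j.+1; last first.
  rewrite mul0r mulr0; case: eqP => [KJ|]; last by rewrite mul0r.
  by rewrite -KJ (negbTE cardK) mulr0.
have tK : t K @: K = first_col.
  rewrite /t; case: pickP => [s /eqP //|none] /=.
  have [s sK] := perm_imset_card (etrans cardK (esym card_first_col)).
  by have := none s; rewrite sK eqxx.
rewrite mul1r /rho_entry -{1}tK (inj_eq (imset_inj (@perm_inj _ (t K)))).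
have [<-|] := eqVneq K J; last by rewrite !(mul0r, mulr0).
by rewrite cardK eqxx !mul1r eta_sqr.
Qed.

Lemma lmul_mxE s :
  lmul_mx F s = fmx (fun h h' : {perm 'I_n.+1} => (h == (s^-1 * h')%g)%:R).
Proof.
by apply/matrixP=> h h'; rewrite !mxE -(inj_eq (mulgI s^-1%g)) mulKg.
Qed.

(** Left multiplication on the column index becomes the action of the inverse; [wedge_charV] later
    removes this inverse. *)
Lemma col_orbit_lmul s : rho F s^-1%g *m col_orbit = col_orbit *m lmul_mx F s.
Proof.
rewrite lmul_mxE !fmxM; apply: eq_fmx => J h.
under [RHS]eq_bigr => h' _ do rewrite mulrC.
by rewrite sum_delta -rho_entryM.
Qed.

(** By [specht_mx_hook] the Specht module is the image of w /\ Lambda^j under [col_orbit], which is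
    injective in degree [j.+1]. *)
Lemma specht_char_hook s : specht_char F l s = wedge_char F (pred1 j.+1) s.
Proof.
have eqA : (leg_orbit *m wedge F n.+1 :=: wedge_proj F n (pred1 j.+1))%MS.
  apply: (eqmx_trans (eqmxMr _ leg_orbit_eqmx)).
  by rewrite (eq_degp F n.+1 (P' := pred1 j.+1 \o succn)) //; apply: wedge_proj_eqmx.
have Adeg : leg_orbit *m wedge F n.+1 *m degp F n.+1 (pred1 j.+1)
          = leg_orbit *m wedge F n.+1.
  rewrite -mulmxA -degp_wedge mulmxA; congr (_ *m _).
  have /submxP[Y ->] : (leg_orbit <= degp F n.+1 (pred1 j))%MS by rewrite leg_orbit_eqmx.
  rewrite -mulmxA degpM; congr (_ *m _); apply: eq_degp => i /=.
  by rewrite eqSS andbb.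
have [coK colK] := col_orbit_inj.
have st := wedge_proj_stable nz2 (pred1 j.+1) s^-1%g.
rewrite /specht_char specht_mx_hook.
rewrite (@restr_trace_inj _ _ _ _ _ _ coK (rho F s^-1%g)); last first.
- exact: col_orbit_lmul.
- by rewrite (eqmx_stable _ eqA).
- by rewrite -Adeg -(mulmxA _ (degp _ _ _)) -(mulmxA _ (_ *m _)) colK Adeg.
by rewrite (restr_trace_eqmx eqA st) restr_trace_wedge_proj // wedge_charV.
Qed.

End HookSpecht.

Lemma is_partition_hook (n j : nat) :
  is_partition n.+1 (hook (n.+1 - j) j) = (j <= n)%N.
Proof.
rewrite /is_partition /= sumn_nseq mul1n all_nseq orbT andbT subn_gt0 ltnS.
have [lejn|_] := leqP j n; last by rewrite !andbF.
rewrite andbT subnK ?eqxx /=; last exact: leqW.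
have : (0 < n.+1 - j)%N by rewrite subn_gt0 ltnS.
by elim: {lejn} j (n.+1 - j)%N => //= j IHj r r_gt0; rewrite r_gt0 IHj.
Qed.

(** For [j] beyond [n] the convention 0 agrees with the absence of subsets of size [j.+1]. *)
Lemma wchar_empty_hook (F : fieldType) (n j : nat)
    (c : {ffun 'I_n.+1 -> bool}) (s : {perm 'I_n.+1}) :
  2%:R != 0 :> F ->
  wchar_empty F (hook (n.+1 - j) j) c s = wedge_char F (pred1 j.+1) s.
Proof.
move=> nz2; rewrite /wchar_empty is_partition_hook.
case: leqP => [lejn|ltnj]; first exact: specht_char_hook.
rewrite /wedge_char /wedge_proj (_ : degp _ _ _ = 0) ?mul0mx ?mxtrace0 //.
apply: matrix_rankP => J K; rewrite fmxE mxE /=.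
have := max_card (mem J); rewrite card_ord.
by have [->|_ _] := eqVneq #|J| j.+1; rewrite ?mulr0 // ltnNge ltnj.
Qed.

(** * The two cocharacters *)

Lemma spans_kermxP (F : fieldType) (N M : nat) (P : 'rV[F]_N -> Prop) (E : 'M[F]_(N, M)) :
  (forall f, f *m E = 0 <-> P f) ->
  spans P (kermx E) /\ forall U : 'M_N, spans P U -> (U :=: kermx E)%MS.
Proof.
move=> PE; have kerP : spans P (kermx E).
  by move=> f; rewrite -PE; split=> /sub_kermxP.
split=> // U spU; apply/eqmxP/andP; split; apply/row_subP => i.
  by apply/kerP/spU/row_sub.
by apply/spU/kerP/row_sub.
Qed.

Lemma pchar0_natr_inj (F : fieldType) : [pchar F] =i pred0 ->
  injective (fun i : nat => i%:R : F).
Proof.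
move=> /pcharf0P F0 i j; wlog leij : i j / (i <= j)%N => [H eij|/eqP].
  by have [le|/ltnW le] := leqP i j; [exact: H | apply/esym/H].
by rewrite eq_sym -subr_eq0 -natrB // F0 subn_eq0 => leji; apply/eqP; rewrite eqn_leq leij.
Qed.

Lemma sum_eq_ord (R : pzSemiRingType) (h k : nat) :
  \sum_(i < k) (h == i)%:R = (h < k)%:R :> R.
Proof.
have [ltk|lek] := ltnP h k.
  rewrite (bigD1 (Ordinal ltk)) //= eqxx big1 ?addr0 // => i.
  by rewrite -(inj_eq val_inj) eq_sym => /negbTE->.
by rewrite big1 // => i _; rewrite gtn_eqF // (leq_trans (ltn_ord i)).
Qed.

Section Cocharacters.

Variables (F : fieldType) (n k : nat).
Hypothesis charF0 : [pchar F] =i pred0.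
Implicit Types (s : {perm 'I_n.+1}) (c : {ffun 'I_n.+1 -> bool}) (U : 'M[F]_(PN n.+1)).

Local Notation evalmx := (evalmx F n.+1).
Local Notation wedge := (wedge F n.+1).
Local Notation degp := (degp F n.+1).

Definition even_le (j : nat) := ~~ odd j && (j <= 2 * k)%N.
Definition odd_le (j : nat) := odd j && (j <= 2 * k)%N.

Lemma two_neq0 : 2%:R != 0 :> F.
Proof. by move/pcharf0P: charF0 => ->. Qed.

Local Notation nz2 := two_neq0.

Lemma mul_row_degp P (v : 'rV[F]_#|{set 'I_n.+1}|) (J : {set 'I_n.+1}) :
  (v *m degp P) 0 (enum_rank J) = v 0 (enum_rank J) * (P #|J|)%:R.
Proof.
rewrite mxE sum_enum_rank.
under eq_bigr => K _ do rewrite fmxE eq_sym mulrCA.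
by rewrite sum_delta.
Qed.

Lemma mul_row_degp_eq0 P (v : 'rV[F]_#|{set 'I_n.+1}|) :
  v *m degp P = 0 <-> forall J : {set 'I_n.+1}, P #|J| -> v 0 (enum_rank J) = 0.
Proof.
split=> [v0 J PJ|v0].
  by have := mul_row_degp P v J; rewrite v0 mxE PJ mulr1.
apply: row_rankP => J; rewrite mul_row_degp mxE.
by case: (boolP (P #|J|)) => [/v0->|_]; rewrite ?mul0r ?mulr0.
Qed.

(** [evalmx_even_wedge] cut off at degree 2k: an odd degree within the bound comes from an even one
    within it. *)
Lemma evalmx_odd_le :
  evalmx *m degp odd_le =
  evalmx *m degp even_le *m (degp (odd_le \o succn) *m wedge).
Proof.
have -> : degp odd_le = degp odd *m degp odd_le.
  by rewrite degpM; apply: eq_degp => j; rewrite /= /odd_le; case: odd.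
rewrite [LHS]mulmxA -evalmx_even_wedge -(mulmxA _ wedge) -degp_wedge !mulmxA.
congr (_ *m _).
rewrite -!mulmxA !degpM; congr (_ *m _); apply: eq_degp => j.
by rewrite /= /odd_le /even_le /=; case: odd => //=; case: ltnP => [/ltnW->|]; rewrite ?andbF.
Qed.

Lemma evalmx_even_le_eqmx : (evalmx *m degp even_le :=: degp even_le)%MS.
Proof.
have evE : degp even_le = degp (predC odd) *m degp even_le.
  by rewrite degpM; apply: eq_degp => j; rewrite /= /even_le; case: odd.
rewrite {1}evE mulmxA [in X in (_ :=: X)%MS]evE.
exact: eqmxMr _ (evalmx_even_eqmx n.+1 nz2).
Qed.

Lemma evalmx_odd_le_eqmx : (evalmx *m degp odd_le :=: wedge_proj F n odd_le)%MS.
Proof.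
rewrite evalmx_odd_le; apply: eqmx_trans (wedge_proj_eqmx n nz2 odd_le).
apply: (eqmx_trans (eqmxMr _ evalmx_even_le_eqmx)).
rewrite mulmxA degpM (eq_degp F n.+1 (P' := odd_le \o succn)) // => j.
by rewrite /= /odd_le /even_le /=; case: odd => //=; case: ltnP => [/ltnW->|]; rewrite ?andbF.
Qed.

Lemma degp_even_leE : degp even_le = \sum_(i < k.+1) degp (pred1 (2 * i)%N).
Proof.
apply: matrix_rankP => J K; rewrite fmxE summxE.
under eq_bigr => i _ do rewrite fmxE.
rewrite -mulr_sumr; congr (_ * _); move: #|J| => j /=; rewrite /even_le.
have [oddj|evj] := boolP (odd j).
  rewrite big1 // => i _; case: eqP => // ji.
  by rewrite ji mul2n odd_double in oddj.
rewrite -[j](even_halfK evj) -mul2n.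
under eq_bigr => i _ do rewrite eqn_pmul2l //.
by rewrite sum_eq_ord leq_pmul2l.
Qed.

Lemma degp_odd_leE : degp odd_le = \sum_(i < k) degp (pred1 (2 * i).+1).
Proof.
apply: matrix_rankP => J K; rewrite fmxE summxE.
under eq_bigr => i _ do rewrite fmxE.
rewrite -mulr_sumr; congr (_ * _); move: #|J| => j /=; rewrite /odd_le.
have [oddj|evj] := boolP (odd j); last first.
  rewrite big1 // => i _; case: eqP => // ji.
  by rewrite ji mul2n /= odd_double in evj.
have {1 2}-> : j = (2 * j./2).+1 by rewrite mul2n odd_halfK // prednK ?odd_gt0.
under eq_bigr => i _ do rewrite eqSS eqn_pmul2l //.
by rewrite sum_eq_ord ltn_pmul2l.
Qed.

Lemma wedge_char_odd_le s :
  wedge_char F odd_le s = \sum_(i < k) wedge_char F (pred1 (2 * i).+1) s.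
Proof.
rewrite /wedge_char /wedge_proj degp_odd_leE !mulmx_suml raddf_sum.
by [].
Qed.

Lemma mxtrace_even_le s :
  \tr (degp even_le *m rho F s)
  = \sum_(i < k.+1) wedge_char F (pred1 (2 * i).+1) s
    + \sum_(i < k) wedge_char F (pred1 (2 * i).+2) s.
Proof.
rewrite degp_even_leE mulmx_suml raddf_sum big_ord_recl [X in _ = X + _]big_ord_recl.
rewrite /= mxtrace_degp_rho0 ?nz2 // -addrA; congr (_ + _).
rewrite -big_split; apply: eq_bigr => i _ /=.
by rewrite mulnS mxtrace_degp_rhoS ?nz2.
Qed.

(** The rank of an idempotent is its trace, here a character value at the identity; characteristic
    zero recovers the natural number. *)
Lemma mxrank_odd_le : \rank (wedge_proj F n odd_le) = (\sum_(i < k) 'C(n, 2 * i))%N.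
Proof.
apply: (pchar0_natr_inj charF0); rewrite mxrank_idem ?wedge_proj_idem ?nz2 //.
rewrite -[wedge_proj _ _ _]mulmx1 -(rho1 F n.+1) -/(wedge_char F odd_le 1%g).
rewrite wedge_char_odd_le natr_sum; apply: eq_bigr => i _.
by rewrite wedge_char1 ?nz2.
Qed.

Lemma mxrank_even_le : \rank (degp even_le) = (\sum_(i < k.+1) 'C(n.+1, 2 * i))%N.
Proof.
apply: (pchar0_natr_inj charF0); rewrite mxrank_idem; last first.
  by rewrite degpM; apply: eq_degp => j /=; rewrite andbb.
rewrite degp_even_leE raddf_sum natr_sum; apply: eq_bigr => i _.
exact: mxtrace_degp.
Qed.

(** Pascal's rule is applied to all terms but the first, which is 1, and the last, which is kept;
    hence the bound [k.-1]. *)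
Lemma sum_binomial_even : (0 < k)%N ->
  (\sum_(i < k.+1) 'C(n.+1, 2 * i) =
   'C(n.+1, 2 * k) + \sum_(i < k.-1) 'C(n, (2 * i).+1) + \sum_(i < k) 'C(n, 2 * i))%N.
Proof.
case: k => // h _ /=; rewrite big_ord_recr /= addnC -addnA; congr (_ + _)%N.
rewrite big_ord_recl [in RHS]big_ord_recl /= muln0 !bin0 addnCA -big_split.
by congr (_ + _)%N; apply: eq_bigr => i _ /=; rewrite /bump add1n mulnS binS addnC.
Qed.

Lemma central_gr_kerP (f : 'rV[F]_(PN n.+1)) :
  f *m (evalmx *m degp odd_le) = 0 <->
  central_gr (@gmul F (2 * k)) (@gone F (2 * k)) (@triv0 F (2 * k)) (@triv1 F (2 * k)) f.
Proof.
have ev2k : ~~ odd (2 * k) by rewrite mul2n odd_double.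
rewrite (central_grP nz2 ev2k) mulmxA mul_row_degp_eq0.
by split=> f0 J; [move=> oddJ leJ | case/andP]; apply: f0; rewrite // /odd_le oddJ.
Qed.

Lemma ident_gr_kerP (f : 'rV[F]_(PN n.+1)) :
  f *m (evalmx *m degp even_le) = 0 <->
  ident_gr (@gmul F (2 * k)) (@gone F (2 * k)) (@triv0 F (2 * k)) (@triv1 F (2 * k)) f.
Proof.
rewrite ident_grP; split=> [f0 J leJ|f0]; last first.
  by rewrite mulmxA; apply/mul_row_degp_eq0 => J /andP[_]; apply: f0.
have [oddJ|evJ] := boolP (odd #|J|); last first.
  by move: f0; rewrite mulmxA => /mul_row_degp_eq0; apply; rewrite /even_le evJ.
(* The conditions on odd sets follow from those on even sets. *)
have : f *m (evalmx *m degp odd_le) = 0 by rewrite evalmx_odd_le (mulmxA f (_ *m _)) f0 mul0mx.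
by rewrite mulmxA => /mul_row_degp_eq0; apply; rewrite /odd_le oddJ.
Qed.

(** The quotient by the kernel is the image of the equivariant map [evalmx *m degp P]. *)
Lemma trace_quotient P U c s :
  (U :=: kermx (evalmx *m degp P))%MS ->
  \tr (actmx F c s) - restr_trace U (actmx F c s)
  = restr_trace (evalmx *m degp P) (rho F s).
Proof.
move=> eqU; have LE : actmx F c s *m (evalmx *m degp P) = evalmx *m degp P *m rho F s.
  by rewrite mulmxA actmx_evalmx -!mulmxA degp_rho.
rewrite (trace_ker_im LE) (restr_trace_eqmx eqU (stablemx_kermx LE)).
by rewrite addrAC subrr add0r.
Qed.

Lemma central_quotient_char c s U :
  (U :=: kermx (evalmx *m degp odd_le))%MS ->
  \tr (actmx F c s) - restr_trace U (actmx F c s)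
  = \sum_(i < k) wedge_char F (pred1 (2 * i).+1) s.
Proof.
move/trace_quotient->; rewrite (restr_trace_eqmx evalmx_odd_le_eqmx); last first.
  exact: wedge_proj_stable nz2 _ _.
by rewrite restr_trace_wedge_proj ?nz2 // wedge_char_odd_le.
Qed.

Lemma ident_quotient_char c s U :
  (U :=: kermx (evalmx *m degp even_le))%MS ->
  \tr (actmx F c s) - restr_trace U (actmx F c s)
  = \sum_(i < k.+1) wedge_char F (pred1 (2 * i).+1) s
    + \sum_(i < k) wedge_char F (pred1 (2 * i).+2) s.
Proof.
have st : stablemx (degp even_le) (rho F s) by rewrite degp_rho submxMl.
move/trace_quotient->; rewrite (restr_trace_eqmx evalmx_even_le_eqmx) //.
rewrite restr_trace_idem ?mxtrace_even_le // degpM.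
by apply: eq_degp => j /=; rewrite andbb.
Qed.

End Cocharacters.

Theorem theorem4p4 (F : fieldType) (charF0 : [pchar F] =i pred0)
    (k n : nat) (hk : (0 < k)%N) (hn : (0 < n)%N) :
  let Cgr := fun f : 'rV[F]_(PN n) => central_gr (@gmul F (2 * k))
               (@gone F (2 * k)) (@triv0 F (2 * k)) (@triv1 F (2 * k)) f in
  let Igr := fun f : 'rV[F]_(PN n) => ident_gr (@gmul F (2 * k))
               (@gone F (2 * k)) (@triv0 F (2 * k)) (@triv1 F (2 * k)) f in
  (exists UC : 'M[F]_(PN n), spans Cgr UC) /\
  (exists UI : 'M[F]_(PN n), spans Igr UI) /\
  forall UC UI : 'M[F]_(PN n), spans Cgr UC -> spans Igr UI ->
  [/\ (* (1) c_n^{gr,z} *)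
      (PN n - \rank UC)%N = (\sum_(i < k) 'C(n.-1, 2 * i))%N,
      (* (2) delta_n^{gr} *)
      (\rank UC - \rank UI)%N
        = ('C(n, 2 * k) + \sum_(i < k.-1) 'C(n.-1, (2 * i).+1))%N,
      (* (3) chi_n^{gr,z} : character of P_n^gr / (P_n^gr cap C^gr) *)
      forall (a : {ffun 'I_n -> bool}) (s : {perm 'I_n}),
        \tr (actmx F a s) - restr_trace UC (actmx F a s)
        = \sum_(i < k) wchar_empty F (hook (n - 2 * i) (2 * i)) a s
    & (* (4) chi_n(Delta^gr) : character of (P_n cap C)/(P_n cap Id) *)
      forall (a : {ffun 'I_n -> bool}) (s : {perm 'I_n}),
        restr_trace UC (actmx F a s) - restr_trace UI (actmx F a s)
        = wchar_empty F (hook (n - 2 * k) (2 * k)) a s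
          + \sum_(i < k) wchar_empty F (hook (n - (2 * i).+1) (2 * i).+1) a s ].
Proof.
case: n hn => // n _ Cgr Igr; have nz2 := two_neq0 charF0.
have [spC eqC] := spans_kermxP (@central_gr_kerP F n k charF0).
have [spI eqI] := spans_kermxP (@ident_gr_kerP F n k).
split; first by exists (kermx (evalmx F n.+1 *m degp F n.+1 (odd_le k))).
split; first by exists (kermx (evalmx F n.+1 *m degp F n.+1 (even_le k))).
move=> UC UI /eqC kerC /eqI kerI.
have rankEC := @mxrank_odd_le F n k charF0; have rankEI := @mxrank_even_le F n k charF0.
rewrite -(@evalmx_odd_le_eqmx F n k charF0) in rankEC.
rewrite -(@evalmx_even_le_eqmx F n k charF0) in rankEI.
have rankC : \rank UC = (PN n.+1 - \sum_(i < k) 'C(n, 2 * i))%N.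
  by rewrite kerC mxrank_ker rankEC.
have rankI : \rank UI = (PN n.+1 - \sum_(i < k.+1) 'C(n.+1, 2 * i))%N.
  by rewrite kerI mxrank_ker rankEI.
(* This bound and the next make the truncated subtractions exact. *)
have leC : (\sum_(i < k) 'C(n, 2 * i) <= PN n.+1)%N.
  by rewrite -rankEC rank_leq_row.
have leI : (\sum_(i < k.+1) 'C(n.+1, 2 * i) <= PN n.+1)%N.
  by rewrite -rankEI rank_leq_row.
split=> [||c s|c s].
- by rewrite rankC subKn.
- by rewrite rankC rankI sum_binomial_even //= in leI *; lia.
- rewrite (central_quotient_char charF0 _ _ kerC).
  by apply: eq_bigr => i _; rewrite wchar_empty_hook.
(* The character of the central polynomials modulo identities is the difference of the characters of
   two quotients of the whole space. *)
have subE (t x y : F) : x - y = (t - y) - (t - x) by ring.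
rewrite (subE (\tr (actmx F c s))) (ident_quotient_char charF0 _ _ kerI).
(* The last even term is the hook with leg 2k; the other even terms cancel against the central
   quotient. *)
rewrite (central_quotient_char charF0 _ _ kerC) big_ord_recr wchar_empty_hook //=.
rewrite -(addrA (\sum_(_ < _) _)) addrAC subrr add0r; congr (_ + _).
by apply: eq_bigr => i _; rewrite wchar_empty_hook.
Qed.
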